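(* Let $v$ be an admissible weight on $\mathbb{R}^{2d}$ (in particular $v\equiv1$ is allowed). If $T\in\mathcal{A}_v$ is invertible in $B(L^2(\mathbb{R}^d))$, then $T^{-1}\in\mathcal{A}_v$. In particular (case $v\equiv 1$), if $T=\sum_{\lambda\in\Lambda}c_\lambda U_\lambda$ with $c\in\ell^1(\mathbb{R}^{2d})$, $\Lambda=\mathrm{supp}(c)$, is invertible in $B(L^2(\mathbb{R}^d))$, then there is $d\in\ell^1(\mathbb{R}^{2d})$ with support $\Sigma$ such that $T^{-1}=\sum_{\sigma\in\Sigma}d_\sigma U_\sigma$.
   Context: For $\lambda=(t,\omega)\in\mathbb{R}^d\times\mathbb{R}^d$, $U_{(t,\omega)}f(x)=e^{i\langle\omega,x\rangle}f(x-t)$ on $L^2(\mathbb{R}^d)$. A weight is a function $v:\mathbb{R}^{2d}\to[0,\infty)$ with $v(0)=1$, $v(-x)=v(x)$, radially non-decreasing. Let $w(r)=\max_{\|x\|=r}v(x)$ (Euclidean norm). $v$ is admissible if $v(x+y)\le v(x)v(y)$ for all $x,y$ and $\lim_{n\to\infty}w(nr)^{1/n}=1$ for all $r\ge0$. $\mathcal{A}_v$ is the Banach algebra of operators $T=\sum_{\lambda\in\mathbb{R}^{2d}}c_\lambda U_\lambda$ with $\|T\|_{\mathcal{A}_v}:=\sum_\lambda v(\lambda)|c_\lambda|<\infty$. $\ell^1(\mathbb{R}^{2d})$ denotes functions $c:\mathbb{R}^{2d}\to\mathbb{C}$ with $\sum_\lambda|c_\lambda|<\infty$, and $\mathrm{supp}(c)=\{\lambda: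 c_\lambda\ne0\}$. *)

(* Defs.v *)
From HB Require Import structures.
From mathcomp Require Import all_boot all_order all_algebra.
From mathcomp Require Import all_classical all_reals all_analysis.
From mathcomp Require Import complex.
Set Implicit Arguments.
Unset Strict Implicit.
Unset Printing Implicit Defensive.
Import Order.TTheory GRing.Theory Num.Theory.
Import numFieldNormedType.Exports.
Local Open Scope classical_set_scope.
Local Open Scope ring_scope.

Section TF.
Variables (R : realType) (d : nat).

(** Points of R^d are row vectors 'rV[R]_d; a point lambda = (t, omega) of R^{2d}
    is a pair of such vectors. *)
Definition vec := 'rV[R]_d.
Definition tfpt := (vec * vec)%type.

Definition dotv (x y : vec) : R := \sum_(i < d) x ord0 i * y ord0 i.

Definition enorm2d (l : tfpt) : R := Num.sqrt (dotv l.1 l.1 + dotv l.2 l.2).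

Definition tf_add (l m : tfpt) : tfpt := (l.1 + m.1, l.2 + m.2).
Definition tf_opp (l : tfpt) : tfpt := (- l.1, - l.2).
Definition tf_scale (s : R) (l : tfpt) : tfpt := (s *: l.1, s *: l.2).
Definition tf_zero : tfpt := (0, 0).

Definition is_weight (v : tfpt -> R) : Prop :=
  [/\ forall l, 0 <= v l,
      v tf_zero = 1,
      forall l, v (tf_opp l) = v l &
      forall l (s r : R), 0 <= s -> s <= r -> v (tf_scale s l) <= v (tf_scale r l)].

Definition wmax (v : tfpt -> R) (r : R) : \bar R :=
  ereal_sup [set (v l)%:E | l in [set l | enorm2d l = r]].

Definition admissible (v : tfpt -> R) : Prop :=
  [/\ is_weight v,
      forall l m, v (tf_add l m) <= v l * v m,
      forall r : R, 0 <= r -> (wmax v r < +oo)%E &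
      forall r : R, 0 <= r ->
        (fun n : nat => powR (fine (wmax v (n%:R * r))) (n%:R)^-1) @ \oo --> (1 : R)].

Definition rsum (I : choiceType) (a : I -> R) : R :=
  fine (\esum_(i in [set: I]) ((Num.max (a i) 0)%:E)) -
  fine (\esum_(i in [set: I]) ((Num.max (- a i) 0)%:E)).

Definition csum (I : choiceType) (a : I -> R[i]) : R[i] :=
  if (\esum_(i in [set: I]) (Normc.normc (a i))%:E < +oo)%E
  then (rsum (fun i => complex.Re (a i)) +i* rsum (fun i => complex.Im (a i)))%C
  else 0.

Definition ell1w (v : tfpt -> R) (c : tfpt -> R[i]) : Prop :=
  (\esum_(l in [set: tfpt]) (v l * Normc.normc (c l))%:E < +oo)%E.

Definition ell1 (c : tfpt -> R[i]) : Prop :=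
  (\esum_(l in [set: tfpt]) (Normc.normc (c l))%:E < +oo)%E.

Definition supp (c : tfpt -> R[i]) : set tfpt := [set l | c l != 0].

Definition fn := vec -> R[i].
Definition op := fn -> fn.

Definition expi (th : R) : R[i] := (cos th +i* sin th)%C.

Definition U (l : tfpt) : op := fun f x => expi (dotv l.2 x) * f (x - l.1).

Definition opsum (c : tfpt -> R[i]) : op :=
  fun f x => csum (fun l => c l * U l f x).

(** Iterated Lebesgue integral over R^d of a nonnegative function
    (equals the integral for Lebesgue measure on R^d for Borel functions,
    by Tonelli). *)
Fixpoint iint (n : nat) : ('rV[R]_n -> \bar R) -> \bar R :=
  match n return ('rV[R]_n -> \bar R) -> \bar R with
  | 0 => fun g => g 0
  | n'.+1 => fun g =>
      (\int[@lebesgue_measure R]_(x in [set: R])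
          iint (fun y : 'rV[R]_n' => g (row_mx (\row_(j < 1) x) y)))%E
  end.

Definition borel_d : set (set vec) := <<s [set: vec], [set U | open U] >>.
Definition borel_fun (g : vec -> R) : Prop :=
  forall A : set R, open A -> borel_d (g @^-1` A).

Definition l2sq (f : fn) : \bar R := iint (fun x => ((Normc.normc (f x)) ^+ 2)%:E).

Definition L2 (f : fn) : Prop :=
  [/\ borel_fun (fun x => complex.Re (f x)),
      borel_fun (fun x => complex.Im (f x)) &
      (l2sq f < +oo)%E].

Definition eqL2 (f g : fn) : Prop := l2sq (fun x => f x - g x) = 0%E.

Definition bounded_op (S : op) : Prop :=
  [/\ forall f, L2 f -> L2 (S f),
      forall f g (a : R[i]), L2 f -> L2 g ->
        eqL2 (S (fun x => a * f x + g x)) (fun x => a * S f x + S g x) &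
      exists C : R, 0 <= C /\ forall f, L2 f -> (l2sq (S f) <= C%:E * l2sq f)%E].

Definition inverse_in_B (T S : op) : Prop :=
  [/\ bounded_op S,
      forall f, L2 f -> eqL2 (S (T f)) f &
      forall f, L2 f -> eqL2 (T (S f)) f].

Definition invertible_in_B (T : op) : Prop :=
  bounded_op T /\ exists S, inverse_in_B T S.

End TF.

(* Main.v *)
(** Twisted convolution turns the finitely supported functions on R^{2d} into a
    ring, represented on L^2(R^d) by g |-> T_g = sum_k g(k) U_k.

    Transference: averaging over modulations of the symbol, |Z| ||g||_2^2 ||phi||^2
    is a finite sum of terms ||T_g U_z phi||^2, hence a lower bound for T_c on
    L^2(R^d) gives the lower bound ||c g||_2 >= delta ||g||_2 on l^2(R^{2d}).  With
    M >= ||c||_v^2 the element a = 1 - c^* c / M then contracts the l^2 norm by a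
    factor q < 1.

    Passage from l^2 to weighted l^1: write a = b + rho with b finitely supported and
    ||rho||_v small.  As R^{2d} is abelian, a^n is a sum of pieces, each supported in
    a translate of the n-fold sums of supp b, a set with at most (n+1)^K points on which
    v grows subexponentially; Cauchy-Schwarz on each piece gives
    ||a^n||_v <= C theta^n with theta < 1 and C uniform in rho.  So the partial sums of
    sum_n a_j^n c_j^* / M, for finitely supported c_j -> c, form a Cauchy sequence in
    the weighted l^1 norm, and their limit is the symbol of the inverse. *)
Require Import Defs.
From HB Require Import structures.
From mathcomp Require Import all_boot all_order all_algebra.
From mathcomp Require Import all_classical all_reals all_analysis.
From mathcomp Require Import complex.
From mathcomp Require Import finmap measurable_realfun ring lra.
Import Order.TTheory GRing.Theory Num.Theory.
Import numFieldNormedType.Exports.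
Local Open Scope classical_set_scope.
Local Open Scope ring_scope.
Set Implicit Arguments.
Unset Strict Implicit.
Unset Printing Implicit Defensive.

(** * Borel sets of row vectors *)

Section borel_rV.
Variable R : realType.

(** A bound in L^2(R^d) does not by itself control coefficients, since the functions U_k phi are not
    orthogonal there. On l^2 of the discrete group R^{2d} they are replaced by orthonormal point
    masses, and the involution makes the expansion of ||f - c^* c f / M||^2 exact; this is why l^2
    stands between the operator norm and the weighted norm.

    The algebra is kept on finite supports, so every product is a finite sum and no infinite twisted
    convolution has to be built. The price is uniformity: all estimates must hold along a whole
    sequence of approximants, so the constant for the powers is fixed by one late approximant b and
    must serve every a near it. Completeness is used once, for the coefficients of the inverse.

    The construction gives e_j c_j -> 1, a left inverse only; the identity T S = 1 on L^2 then
    identifies its limit with S. Factors 2 in the L^2 bounds come from (x + y)^2 <= 2 x^2 + 2 y^2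
    and from treating real and imaginary parts apart; only the l^2 contraction has to be sharp. *)

Definition brV (n : nat) : Type := g_sigma_algebraType (@open 'rV[R]_n).
HB.instance Definition _ n := Measurable.on (brV n).

Lemma brV_open n (U : set 'rV[R]_n) : open U -> measurable (U : set (brV n)).
Proof. by move=> oU; apply: sub_sigma_algebra. Qed.

Lemma brV_measurable_fun d (T : measurableType d) n (f : T -> brV n) :
  (forall U : set 'rV[R]_n, open U -> measurable (f @^-1` U)) ->
  measurable_fun setT f.
Proof.
move=> mf; apply: (@measurability _ _ _ _ setT f (@open 'rV[R]_n)) => //.
by move=> _ [U oU <-]; rewrite setTI; exact: mf.
Qed.

Lemma brV_continuous_measurable n (f : 'rV[R]_n -> R) :
  continuous f -> measurable_fun setT (f : brV n -> R).
Proof.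
move=> cf; apply: (measurability _ (RGenOpens.measurableE R)) => //.
move=> _ [_ [a [b ->]] <-]; rewrite setTI; apply: brV_open.
by apply: open_comp => // x _; exact: cf.
Qed.

Lemma brV_translation_measurable n (t : 'rV[R]_n) :
  measurable_fun setT ((fun x => x - t) : brV n -> brV n).
Proof.
apply: brV_measurable_fun => U oU; apply: brV_open; apply: open_comp => // x _.
by apply: continuousB => //; exact: cst_continuous.
Qed.

Lemma borel_funP n (g : 'rV[R]_n -> R) :
  borel_fun g <-> measurable_fun setT (g : brV n -> R).
Proof.
split=> [bg|mg A oA].
  apply: (measurability _ (RGenOpens.measurableE R)) => //.
  by move=> _ [_ [a [b ->]] <-]; rewrite setTI; apply: bg; exact: interval_open.
have := mg measurableT A (open_measurable oA).
by rewrite setTI.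
Qed.

(** An open set is the union of the countably many cubes with rational centre and radius 1/(k+1)
    that it contains, and the preimage of a cube is a finite intersection of coordinate
    conditions. *)
Lemma brV_coord_measurable d (T : measurableType d) n (f : T -> brV n) :
  (forall j, measurable_fun setT (fun x => (f x : 'rV[R]_n) ord0 j)) ->
  measurable_fun setT f.
Proof.
move=> mf; apply: brV_measurable_fun => U oU.
pose B (q : 'rV[rat]_n) (k : nat) : set 'rV[R]_n :=
  [set y | forall j, `|ratr (q ord0 j) - y ord0 j| < k.+1%:R^-1].
have -> : f @^-1` U = \bigcup_(q in [set: 'rV[rat]_n])
    \bigcup_(k in [set k | B q k `<=` U]) f @^-1` (B q k).
  apply/seteqP; split=> [x /= Ufx|x [q _ [k BU Bfx]]]; last exact: BU.
  have /nbhs_ballP[e e0 eU] : nbhs (f x : 'rV[R]_n) U by apply: open_nbhs_nbhs.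
  (* A cube that contains [f x] stays within two of its radii of [f x], hence the factor 2. *)
  have [k ke] : exists k, 2 * k.+1%:R^-1 < e :> R.
    have := near_infty_natSinv_lt (PosNum (divr_gt0 e0 (@ltr0n R 2))).
    move=> [k _ /(_ k (leqnn _)) /= ke]; exists k.
    by rewrite mulrC -ltr_pdivlMr.
  have hq j : exists q : rat, `|ratr q - (f x : 'rV[R]_n) ord0 j| < k.+1%:R^-1.
    have hlt : (f x : 'rV[R]_n) ord0 j - k.+1%:R^-1 <
               (f x : 'rV[R]_n) ord0 j + k.+1%:R^-1.
      by rewrite ltrBlDr -addrA ltrDl addr_gt0.
    have [q] := rat_in_itvoo hlt.
    rewrite in_itv/= => /andP[h1 h2]; exists q.
    by rewrite ltr_distl h1 h2.
  exists (\row_j projT1 (cid (hq j))) => //; exists k => /=; last first.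
    by move=> j; rewrite mxE; case: cid.
  move=> y By; apply: eU; split => // i j; rewrite !ord1.
  have := By j; rewrite mxE; case: cid => q /= hq1 hq2.
  rewrite /ball/= (le_lt_trans _ ke)//.
  rewrite (le_trans (ler_distD (ratr q) _ _))// mulr2n mulrDl mul1r lerD//.
  - by rewrite distrC ltW.
  - exact: ltW.
apply: countable_bigcupT_measurable => [|q]; first exact: countableP.
apply: bigcup_measurable => k _.
have -> : f @^-1` B q k = \bigcap_(j in [set: 'I_n])
   ((fun x => `|ratr (q ord0 j) - (f x : 'rV[R]_n) ord0 j|) @^-1` `]-oo, k.+1%:R^-1[%classic).
  apply/seteqP; split=> [x /= Bx j _|x Bx j]; first by rewrite /= in_itv/=.
  by have := Bx j I; rewrite /= in_itv/=.
apply: fin_bigcap_measurable => // j _.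
rewrite -[X in measurable X]setTI; apply: measurableT_comp => //.
exact: measurable_funB.
Qed.

Lemma row_mx_measurable n :
  measurable_fun setT
    ((fun p => row_mx (\row_(j < 1) p.1) p.2) : R * brV n -> brV n.+1).
Proof.
apply: brV_coord_measurable => j.
have [k ->|k ->] := split_ordP (j : 'I_(1 + n)).
  rewrite (_ : (fun x => _) = fst); first exact: measurable_fst.
  by apply/funext => x; apply: etrans (row_mxEl _ _ _ _) _; rewrite mxE.
rewrite (_ : (fun x => _) = (fun y : 'rV[R]_n => y ord0 k) \o snd); last first.
  by apply/funext => x; apply: etrans (row_mxEr _ _ _ _) _.
apply: (@measurableT_comp _ _ _ _ _ _ (_ : brV n -> _)); last exact: measurable_snd.
by apply: brV_continuous_measurable => x; exact: coord_continuous.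
Qed.
End borel_rV.

(** * Measurability of partial iterated integrals *)

Section iint.
Local Open Scope ereal_scope.
Variable R : realType.
Notation mu := (@lebesgue_measure R).

Lemma iint_ge0 n (g : 'rV[R]_n -> \bar R) : (forall x, 0 <= g x) -> 0 <= iint g.
Proof.
elim: n g => [|n IH] g g0 //=.
by apply: integral_ge0 => x _; exact: IH.
Qed.

(** The parameter space [T] varies in the induction: the coordinate peeled off by [iint] joins the
    parameters, and one-dimensional Tonelli then integrates it out. *)
Lemma iint_section_measurable d (T : measurableType d) n
    (g : T -> brV R n -> \bar R) :
  measurable_fun setT (fun p : T * brV R n => g p.1 p.2) ->
  (forall t x, 0 <= g t x) ->
  measurable_fun setT (fun t => iint (g t)).
Proof.
elim: n => [|n IH] in d T g * => mg g0 /=.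
  exact: (measurableT_comp mg (measurable_fun_pair
    (@measurable_id _ T setT) (@measurable_cst _ _ T (brV R 0) setT 0%R))).
pose h (p : T * R) := iint (fun y : 'rV[R]_n =>
  g p.1 (row_mx (\row_(j < 1) p.2) y : brV R n.+1)).
apply: (@measurable_fun_fubini_tonelli_F _ _ _ _ _ mu h).
  apply: (IH _ (T * R)%type (fun p y => g p.1 (row_mx (\row_(j < 1) p.2) y : brV R n.+1))) => //.
  have m12 : measurable_fun setT (fun q : T * R * brV R n => (q.1.2, q.2)).
    apply: measurable_fun_pair => //.
    exact: (measurableT_comp measurable_snd measurable_fst).
  have m11 : measurable_fun setT (fun q : T * R * brV R n => q.1.1).
    exact: (measurableT_comp measurable_fst measurable_fst).
  exact: (measurableT_comp mg (measurable_fun_pair m11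
    (measurableT_comp (@row_mx_measurable R n) m12))).
by move=> p; exact: iint_ge0.
Qed.
End iint.

(** * Calculus of the iterated integral *)

Section iint_theory.
Local Open Scope ereal_scope.
Variable R : realType.
Notation mu := (@lebesgue_measure R).

Definition slice n (g : 'rV[R]_n.+1 -> \bar R) (x : R) (y : 'rV[R]_n) :=
  g (row_mx (\row_(j < 1) x) y).

Lemma slice_measurable n (g : brV R n.+1 -> \bar R) x :
  measurable_fun setT g -> measurable_fun setT (slice g x : brV R n -> \bar R).
Proof.
move=> mg.
exact: (measurableT_comp mg (measurableT_comp (@row_mx_measurable R n)
  (measurable_fun_pair (@measurable_cst _ _ (brV R n) R setT x) (@measurable_id _ (brV R n) setT)))).
Qed.

Lemma iint_slice_measurable n (g : brV R n.+1 -> \bar R) :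
  measurable_fun setT g -> (forall x, 0 <= g x) ->
  measurable_fun setT (fun x : R => iint (slice g x)).
Proof.
move=> mg g0; apply: (@iint_section_measurable _ _ _ n (slice g)) => [|t x].
  exact: (measurableT_comp mg (@row_mx_measurable R n)).
exact: g0.
Qed.

Lemma iint_eq n (f g : 'rV[R]_n -> \bar R) : f =1 g -> iint f = iint g.
Proof. by move=> /funext ->. Qed.

Lemma le_iint n (f g : brV R n -> \bar R) :
  measurable_fun setT f -> measurable_fun setT g ->
  (forall x, 0 <= f x) -> (forall x, f x <= g x) -> iint f <= iint g.
Proof.
elim: n => [|n IH] in f g * => mf mg f0 fg //=.
have g0 x : 0 <= g x by exact: le_trans (fg x).
apply: ge0_le_integral => //.
- by move=> x _; exact: iint_ge0.
- exact: iint_slice_measurable.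
- exact: iint_slice_measurable.
by move=> x _; apply: IH => //; exact: slice_measurable.
Qed.

Lemma iintD n (f g : brV R n -> \bar R) :
  measurable_fun setT f -> measurable_fun setT g ->
  (forall x, 0 <= f x) -> (forall x, 0 <= g x) ->
  iint (fun x => f x + g x) = iint f + iint g.
Proof.
elim: n => [|n IH] in f g * => mf mg f0 g0 //=.
rewrite -ge0_integralD//=.
- by apply: eq_integral => x _; apply: IH => //; exact: slice_measurable.
- by move=> x _; exact: iint_ge0.
- exact: iint_slice_measurable.
- by move=> x _; exact: iint_ge0.
- exact: iint_slice_measurable.
Qed.

Lemma iintZl n (k : R) (f : brV R n -> \bar R) : (0 <= k)%R ->
  measurable_fun setT f -> (forall x, 0 <= f x) ->
  iint (fun x => k%:E * f x) = k%:E * iint f.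
Proof.
move=> k0; elim: n => [|n IH] in f * => mf f0 //=.
rewrite -ge0_integralZl_EFin//=.
- by apply: eq_integral => x _; apply: IH => //; exact: slice_measurable.
- by move=> x _; exact: iint_ge0.
- exact: iint_slice_measurable.
Qed.

Lemma iint_zero n : iint (fun _ : 'rV[R]_n => 0) = 0 :> \bar R.
Proof.
by elim: n => [//|n IH] /=; rewrite [LHS]integral0_eq// => x _; exact: IH.
Qed.

Lemma iint_nneseries n (f : nat -> brV R n -> \bar R) :
  (forall k, measurable_fun setT (f k)) -> (forall k x, 0 <= f k x) ->
  iint (fun x => \sum_(k <oo) f k x) = \sum_(k <oo) iint (f k).
Proof.
elim: n => [|n IH] in f * => mf f0 //=.
rewrite -(@integral_nneseries _ _ _ mu setT measurableT (fun k x => iint (slice (f k) x)))//=.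
- apply: eq_integral => x _; apply: (IH (fun k => slice (f k) x)) => //.
  - by move=> k; exact: slice_measurable.
  - by move=> k y; exact: f0.
- by move=> k; exact: (iint_slice_measurable (mf k) (f0 k)).
- by move=> k x _; apply: iint_ge0 => y; exact: f0.
Qed.

(** The pushforward of Lebesgue measure under a translation agrees with it on half-open intervals,
    and these determine it. *)
Lemma lebesgue_integral_translation (t : R) (f : R -> \bar R) :
  measurable_fun setT f -> (forall x, 0 <= f x) ->
  \int[mu]_x f (x - t)%R = \int[mu]_x f x.
Proof.
move=> mf f0.
have mphi : measurable_fun setT ((fun x => x - t)%R : measurableTypeR R -> measurableTypeR R).
  exact: measurable_funB.
rewrite -(@ge0_integral_pushforward _ _ _ _ _ _ mphi mu setT f)//.
apply: eq_measure_integral => A mA _.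
apply/esym/lebesgue_measure_unique => //= _ [[a b]] _ <-.
rewrite /pushforward.
have -> : ((fun x => x - t)%R @^-1` `]a, b]%classic = `]a + t, b + t]%classic)%R.
  by apply/seteqP; split => x /=; rewrite !in_itv/= ltrBrDr lerBlDr.
by rewrite !lebesgue_measure_itv/= !lte_fin ltrD2r -!EFinB opprD addrACA subrr addr0.
Qed.

Lemma iint_translation n (t : 'rV[R]_n) (f : brV R n -> \bar R) :
  measurable_fun setT f -> (forall x, 0 <= f x) ->
  iint (fun x => f (x - t)%R) = iint f.
Proof.
elim: n => [|n IH] in f t * => mf f0 /=.
  by congr f; apply/rowP => -[].
rewrite -(@lebesgue_integral_translation (t ord0 ord0) (fun x => iint (slice f x))).
- apply: eq_integral => x _.
  rewrite -(IH (slice f (x - t ord0 ord0)%R) (@rsubmx _ 1 1 n t)); last 2 first.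
  - exact: slice_measurable.
  - by move=> y; exact: f0.
  apply: iint_eq => y; congr f; apply/rowP => j.
  have [k ->|k ->] := split_ordP (j : 'I_(1 + n)).
    apply: etrans _ (esym (row_mxEl _ _ _ _)).
    rewrite [LHS]mxE [X in (_ + X)%R]mxE [RHS]mxE; congr (_ - t _ _)%R.
      by apply: etrans (row_mxEl _ _ _ _) _; rewrite mxE.
    by apply/val_inj => /=; rewrite ord1.
  apply: etrans _ (esym (row_mxEr _ _ _ _)).
  rewrite [LHS]mxE [X in (_ + X)%R]mxE [RHS]mxE [X in _ = (_ + X)%R]mxE.
  rewrite [X in _ = (_ - X)%R]mxE; congr (_ - _)%R.
  exact: (row_mxEr _ _ _ _).
- exact: iint_slice_measurable.
- by move=> x; apply: iint_ge0 => y; exact: f0.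
Qed.
End iint_theory.

(** * Unordered sums of nonnegative terms *)

Section esum_seq.
Variables (R : realType) (I : choiceType).
Implicit Types (a : I -> \bar R) (J : seq I).

Lemma seq_le_esum a J : uniq J -> (forall i, 0 <= a i)%E ->
  (\sum_(i <- J) a i <= \esum_(i in [set: I]) a i)%E.
Proof.
move=> uJ a0; apply: ereal_sup_ubound; exists [set` J]; last by rewrite -fsbig_seq.
by split => //; exact: finite_seq.
Qed.

Lemma esum_le_seq a M :
  (forall J, uniq J -> \sum_(i <- J) a i <= M)%E ->
  (\esum_(i in [set: I]) a i <= M)%E.
Proof.
move=> aM; apply: ge_ereal_sup => _ [A [finA _] <-].
by rewrite fsbig_finite//; apply: aM; exact: finmap.fset_uniq.
Qed.

Lemma esum_seq a J : uniq J -> (forall i, 0 <= a i)%E ->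
  (forall i, i \notin J -> a i = 0)%E ->
  (\esum_(i in [set: I]) a i = \sum_(i <- J) a i)%E.
Proof.
move=> uJ a0 aJ; transitivity (\esum_(i in [set` J]) a i)%E.
  rewrite [RHS]esum_mkcond; apply: eq_esum => i _.
  by case: ifPn => //; rewrite notin_setE/= => /negP /aJ.
by rewrite esum_fset// -fsbig_seq.
Qed.

(** The support is the union of the level sets where [a] is at least 1/(k+1). Each is finite: more
    than (k+1) times the total many points would already exceed the total. *)
Lemma esum_countable_support a : (forall i, 0 <= a i)%E ->
  (\esum_(i in [set: I]) a i < +oo)%E -> countable [set i | a i != 0%E].
Proof.
move=> a0 afin.
have -> : [set i | a i != 0%E] = \bigcup_k [set i | (k.+1%:R^-1%:E <= a i)%E].
  apply/seteqP; split=> [i /= ai|i [k _ /= ki]]; last first.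
    by rewrite gt_eqF// (lt_le_trans _ ki)// lte_fin invr_gt0.
  have {}ai : (0 < a i)%E by rewrite lt0e ai a0.
  have aioo : (a i < +oo)%E.
    apply: le_lt_trans afin; have := @seq_le_esum a [:: i] isT a0.
    by rewrite big_seq1.
  have afn : a i \is a fin_num by rewrite ge0_fin_numE.
  have fa0 : 0 < fine (a i) by rewrite fine_gt0// ai.
  have [k _ /(_ k (leqnn _)) /= ke] := near_infty_natSinv_lt (PosNum fa0).
  by exists k => //=; rewrite -(fineK afn) lee_fin ltW.
apply: bigcup_countable => // k _; apply: finite_set_countable.
apply: contrapT => infk.
have [F Fsub Fcard] := @infinite_set_fset _ _
  (Num.truncn (fine (\esum_(i in [set: I]) a i)%E * k.+1%:R)).+1 infk.
have aoo : (\esum_(i in [set: I]) a i) \is a fin_num.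
  by rewrite ge0_fin_numE// esum_ge0.
have := @seq_le_esum a (finmap.enum_fset F) (finmap.fset_uniq F) a0.
rewrite leNgt => /negP; apply.
apply: (@lt_le_trans _ _ (\sum_(i <- finmap.enum_fset F) k.+1%:R^-1%:E)%E); last first.
  by rewrite big_seq [leRHS]big_seq; apply: lee_sum => i iF; apply: Fsub.
rewrite sumEFin big_const_seq count_predT iter_addr addr0.
rewrite -(fineK aoo) lte_fin -[ltRHS]mulr_natl ltr_pdivlMr//.
by rewrite (lt_le_trans (truncnS_gt _))// ler_nat.
Qed.
End esum_seq.

(** * Cauchy-Schwarz and unordered real sums *)

Section sums.
Variables (R : realType) (I : choiceType).
Implicit Types (a b : I -> R) (p u : I -> R) (J : seq I).

(** The quadratic Q - 2 t S + t^2 P is the sum of the p_i (u_i - t)^2, hence nonnegative; for P > 0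
    it is evaluated at its minimum S / P. *)
Lemma weighted_cauchy_schwarz (T : Type) (J : seq T) (p u : T -> R) :
  (forall i, 0 <= p i) ->
  (\sum_(i <- J) p i * u i) ^+ 2 <=
  (\sum_(i <- J) p i) * \sum_(i <- J) p i * u i ^+ 2.
Proof.
move=> p0; set S := \sum_(i <- J) p i * u i; set P := \sum_(i <- J) p i.
set Q := \sum_(i <- J) _.
have key t : 0 <= Q - 2 * t * S + t ^+ 2 * P.
  rewrite /Q /S /P !mulr_sumr -sumrB -big_split/=.
  apply: sumr_ge0 => i _.
  have -> : p i * u i ^+ 2 - 2 * t * (p i * u i) + t ^+ 2 * p i = p i * (u i - t) ^+ 2 by ring.
  by rewrite mulr_ge0// sqr_ge0.
have P0 : 0 <= P by apply: sumr_ge0.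
have [P0'|Pn0] := eqVneq P 0.
  (* For P = 0 the quadratic is affine in t, and unless S = 0 this value of t makes it equal to
     -1. *)
  rewrite P0' mul0r; have := key ((Q + 1) * S / 2 / S ^+ 2).
  have [->|S0] := eqVneq S 0; first by rewrite expr0n.
  rewrite P0' mulr0 addr0.
  have -> : Q - 2 * ((Q + 1) * S / 2 / S ^+ 2) * S = -1 by field.
  by rewrite oppr_ge0 ler10.
have Pp : 0 < P by rewrite lt_def Pn0.
have := mulr_ge0 P0 (key (S / P)).
have -> : P * (Q - 2 * (S / P) * S + (S / P) ^+ 2 * P) = P * Q - S ^+ 2 by field.
by rewrite subr_ge0.
Qed.

Lemma rsum_finite a J : uniq J -> (forall i, i \notin J -> a i = 0) ->
  rsum a = \sum_(i <- J) a i.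
Proof.
move=> uJ aJ; rewrite /rsum.
rewrite (@esum_seq _ _ _ J)//; last 2 first.
- by move=> i; rewrite lee_fin le_max lexx orbT.
- by move=> i /aJ ->; rewrite maxxx.
rewrite (@esum_seq _ _ _ J)//; last 2 first.
- by move=> i; rewrite lee_fin le_max lexx orbT.
- by move=> i /aJ ->; rewrite oppr0 maxxx.
rewrite !sumEFin/= -sumrB; apply: eq_bigr => i _.
by case: (leP (a i) 0) => h; case: (leP (- a i) 0) => h'; lra.
Qed.

Let pos_ge0 a i : (0 <= (Num.max (a i) 0)%:E)%E.
Proof. by rewrite lee_fin le_max lexx orbT. Qed.

Lemma esum_norm_fin a : (\esum_(i in [set: I]) `|a i|%:E < +oo)%E ->
  (\esum_(i in [set: I]) `|a i|%:E)%E \is a fin_num.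
Proof. by move=> af; rewrite ge0_fin_numE// esum_ge0. Qed.

Lemma esum_pos_fin a : (\esum_(i in [set: I]) `|a i|%:E < +oo)%E ->
  (\esum_(i in [set: I]) (Num.max (a i) 0)%:E)%E \is a fin_num.
Proof.
move=> afin; rewrite ge0_fin_numE ?esum_ge0//; apply: le_lt_trans afin.
apply: le_esum => i _; rewrite lee_fin ge_max normr_ge0 ler_norm//.
Qed.

Lemma esum_neg_fin a : (\esum_(i in [set: I]) `|a i|%:E < +oo)%E ->
  (\esum_(i in [set: I]) (Num.max (- a i) 0)%:E)%E \is a fin_num.
Proof.
by move=> afin; apply: (@esum_pos_fin (fun i => - a i)); under eq_esum do rewrite normrN.
Qed.

Lemma rsumD a b : (\esum_(i in [set: I]) `|a i|%:E < +oo)%E ->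
  (\esum_(i in [set: I]) `|b i|%:E < +oo)%E ->
  rsum (fun i => a i + b i) = rsum a + rsum b.
Proof.
move=> af bf.
have abf : (\esum_(i in [set: I]) `|a i + b i|%:E < +oo)%E.
  apply: (@le_lt_trans _ _ (\esum_(i in [set: I]) (`|a i|%:E + `|b i|%:E)%E)).
    by apply: le_esum => i _; rewrite -EFinD lee_fin ler_normD.
  by rewrite esumD// lte_add_pinfty.
(* Positive and negative parts are not additive. Moving the subtracted parts to the other side
   leaves an identity between sums of nonnegative terms, where [esumD] applies. *)
have E : (\esum_(i in [set: I]) (Num.max (a i + b i) 0)%:E +
   (\esum_(i in [set: I]) (Num.max (- a i) 0)%:E +
    \esum_(i in [set: I]) (Num.max (- b i) 0)%:E) =
   \esum_(i in [set: I]) (Num.max (- (a i + b i)) 0)%:E +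
   (\esum_(i in [set: I]) (Num.max (a i) 0)%:E +
    \esum_(i in [set: I]) (Num.max (b i) 0)%:E))%E.
  rewrite -!esumD//; try by move=> i _; rewrite ?adde_ge0 ?lee_fin ?le_max ?lexx ?orbT.
  apply: eq_esum => i _; rewrite -!EFinD; congr (_%:E).
  have posneg (x : R) : Num.max x 0 = Num.max (- x) 0 + x.
    by case: (leP x 0) => h; case: (leP (- x) 0) => h'; lra.
  by rewrite (posneg (a i + b i)) (posneg (a i)) (posneg (b i)); ring.
move: E; rewrite /rsum.
rewrite -(fineK (esum_pos_fin af)) -(fineK (esum_neg_fin af)).
rewrite -(fineK (esum_pos_fin bf)) -(fineK (esum_neg_fin bf)).
rewrite -(fineK (esum_pos_fin abf)) -(fineK (esum_neg_fin abf)).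
rewrite -!EFinD => -[] /=; lra.
Qed.

Lemma normr_rsum_le a : (\esum_(i in [set: I]) `|a i|%:E < +oo)%E ->
  `|rsum a| <= fine (\esum_(i in [set: I]) `|a i|%:E)%E.
Proof.
move=> af; rewrite /rsum.
have ap : fine (\esum_(i in [set: I]) (Num.max (a i) 0)%:E)%E <= fine (\esum_(i in [set: I]) `|a i|%:E)%E.
  apply: fine_le; [exact: esum_pos_fin|exact: esum_norm_fin|].
  by apply: le_esum => i _; rewrite lee_fin ge_max normr_ge0 ler_norm.
have an : fine (\esum_(i in [set: I]) (Num.max (- a i) 0)%:E)%E <= fine (\esum_(i in [set: I]) `|a i|%:E)%E.
  apply: fine_le; [exact: esum_neg_fin|exact: esum_norm_fin|].
  by apply: le_esum => i _; rewrite lee_fin ge_max normr_ge0 -normrN ler_norm.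
have ap0 : 0 <= fine (\esum_(i in [set: I]) (Num.max (a i) 0)%:E)%E by rewrite fine_ge0// esum_ge0.
have an0 : 0 <= fine (\esum_(i in [set: I]) (Num.max (- a i) 0)%:E)%E.
  by rewrite fine_ge0// esum_ge0// => i _; rewrite lee_fin le_max lexx orbT.
rewrite ler_norml; lra.
Qed.
End sums.

(** * Unordered complex sums *)

Section complex_sums.
Variables (R : realType) (I : choiceType).
Local Notation normc := (@Normc.normc R).
Implicit Types (a b : I -> R[i]) (J : seq I).

Lemma sqr_normc (z : R[i]) : normc z ^+ 2 = complex.Re z ^+ 2 + complex.Im z ^+ 2.
Proof. by case: z => x y /=; rewrite sqr_sqrtr// addr_ge0// sqr_ge0. Qed.

Lemma normc_ge0 (z : R[i]) : 0 <= normc z.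
Proof. by case: z => x y; rewrite /= sqrtr_ge0. Qed.

Lemma normr_Re_le (z : R[i]) : `|complex.Re z| <= normc z.
Proof.
rewrite -(@ler_pXn2r _ 2)// ?nnegrE ?normc_ge0// sqr_normc real_normK ?num_real//.
by rewrite lerDl sqr_ge0.
Qed.

Lemma normr_Im_le (z : R[i]) : `|complex.Im z| <= normc z.
Proof.
rewrite -(@ler_pXn2r _ 2)// ?nnegrE ?normc_ge0// sqr_normc real_normK ?num_real//.
by rewrite lerDr sqr_ge0.
Qed.

Lemma esum_Re_fin a : (\esum_(i in [set: I]) (normc (a i))%:E < +oo)%E ->
  (\esum_(i in [set: I]) `|complex.Re (a i)|%:E < +oo)%E.
Proof. by apply: le_lt_trans; apply: le_esum => i _; rewrite lee_fin normr_Re_le. Qed.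

Lemma esum_Im_fin a : (\esum_(i in [set: I]) (normc (a i))%:E < +oo)%E ->
  (\esum_(i in [set: I]) `|complex.Im (a i)|%:E < +oo)%E.
Proof. by apply: le_lt_trans; apply: le_esum => i _; rewrite lee_fin normr_Im_le. Qed.

(** An infinite [csum] enters the estimates through its distance to a finite sum, so this replaces
    general linearity. The factor 2 comes from bounding real and imaginary parts by the same
    total. *)
Lemma csum_approx a b J : uniq J -> (forall i, i \notin J -> b i = 0) ->
  (\esum_(i in [set: I]) (normc (a i - b i))%:E < +oo)%E ->
  normc (csum a - \sum_(i <- J) b i) ^+ 2 <=
  2 * (fine (\esum_(i in [set: I]) (normc (a i - b i))%:E)%E) ^+ 2.
Proof.
move=> uJ bJ abf.
have bf : (\esum_(i in [set: I]) (normc (b i))%:E < +oo)%E.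
  rewrite (esum_seq uJ)//; first by rewrite sumEFin ltry.
  - by move=> i; rewrite lee_fin normc_ge0.
  - by move=> i /bJ ->; rewrite Normc.normc0.
(* Absolute convergence of [a] keeps [csum a] off its default value 0. *)
have af : (\esum_(i in [set: I]) (normc (a i))%:E < +oo)%E.
  apply: (@le_lt_trans _ _ (\esum_(i in [set: I]) ((normc (a i - b i))%:E + (normc (b i))%:E)%E)).
    apply: le_esum => i _; rewrite -EFinD lee_fin -[X in normc X <= _](subrK (b i)).
    exact: le_normcD.
  by rewrite esumD// ?lte_add_pinfty// => i _; rewrite lee_fin normc_ge0.
have Re_sum : complex.Re (\sum_(i <- J) b i) = \sum_(i <- J) complex.Re (b i) by rewrite raddf_sum.
have Im_sum : complex.Im (\sum_(i <- J) b i) = \sum_(i <- J) complex.Im (b i) by rewrite raddf_sum.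
have bJRe i : i \notin J -> complex.Re (b i) = 0 by move=> /bJ ->.
have bJIm i : i \notin J -> complex.Im (b i) = 0 by move=> /bJ ->.
have dRe : rsum (fun i => complex.Re (a i)) - complex.Re (\sum_(i <- J) b i) =
    rsum (fun i => complex.Re (a i - b i)).
  rewrite Re_sum -(rsum_finite uJ bJRe).
  rewrite -[X in X - _](_ : rsum (fun i => complex.Re (a i - b i) + complex.Re (b i)) = _); last first.
    by congr rsum; apply/funext => i; rewrite -raddfD subrK.
  by rewrite (rsumD (esum_Re_fin abf) (esum_Re_fin bf)) addrK.
have dIm : rsum (fun i => complex.Im (a i)) - complex.Im (\sum_(i <- J) b i) =
    rsum (fun i => complex.Im (a i - b i)).
  rewrite Im_sum -(rsum_finite uJ bJIm).
  rewrite -[X in X - _](_ : rsum (fun i => complex.Im (a i - b i) + complex.Im (b i)) = _); last first.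
    by congr rsum; apply/funext => i; rewrite -raddfD subrK.
  by rewrite (rsumD (esum_Im_fin abf) (esum_Im_fin bf)) addrK.
rewrite /csum af sqr_normc !raddfB/= dRe dIm.
set s := fine _.
have fin0 : (\esum_(i in [set: I]) (normc (a i - b i))%:E)%E \is a fin_num.
  by rewrite ge0_fin_numE// esum_ge0// => i _; rewrite lee_fin normc_ge0.
have h1 : `|rsum (fun i => complex.Re (a i - b i))| <= s.
  apply: le_trans (normr_rsum_le (esum_Re_fin abf)) _.
  apply: fine_le => //; first exact: (esum_norm_fin (esum_Re_fin abf)).
  by apply: le_esum => i _; rewrite lee_fin normr_Re_le.
have h2 : `|rsum (fun i => complex.Im (a i - b i))| <= s.
  apply: le_trans (normr_rsum_le (esum_Im_fin abf)) _.
  apply: fine_le => //; first exact: (esum_norm_fin (esum_Im_fin abf)).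
  by apply: le_esum => i _; rewrite lee_fin normr_Im_le.
rewrite mulr2n mulrDl mul1r -[leLHS]/(_ + _) lerD//.
- by rewrite -[leLHS]real_normK ?num_real// lerXn2r ?nnegrE// (le_trans _ h1).
- by rewrite -[leLHS]real_normK ?num_real// lerXn2r ?nnegrE// (le_trans _ h2).
Qed.
End complex_sums.

(** * Countably supported sums under the integral *)

Section countable_esum.
Variables (R : realType) (I : choiceType).

(** The enumeration [g] is chosen before [a], so that one series represents the sum at all points
    simultaneously. [None] pads the indices that enumerate nothing. *)
Lemma countable_esum_series (A : set I) : countable A ->
  exists (g : nat -> option I), forall a : I -> \bar R,
    (forall i, 0 <= a i)%E -> (forall i, ~ A i -> a i = 0%E) ->
    (\esum_(i in [set: I]) a i = \sum_(k <oo) oapp a 0 (g k))%E.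
Proof.
move=> /countable_bijP[B].
elim/choicePpointed: I A => [I0 A _|I0 A].
  exists (fun=> None) => a a0 aA.
  rewrite [X in (\esum_(i in X) _)%E](_ : _ = set0); last by rewrite emptyE.
  by rewrite esum_set0 eseries0.
rewrite card_eq_sym => /card_set_bijP[f bf].
exists (fun k => if k \in B then Some (f k) else None) => a a0 aA.
transitivity (\esum_(i in A) a i)%E.
  rewrite [RHS]esum_mkcond; apply: eq_esum => i _.
  by case: ifPn => //; rewrite notin_setE => /aA.
rewrite (reindex_esum B A f)// esum_mkcond nneseries_esumT; last first.
  by move=> k; case: ifP => //= _; exact: a0.
by apply: eq_esum => k _; case: ifP.
Qed.

Lemma esum_measurable d (T : measurableType d) (A : set I) (a : I -> T -> \bar R) :
  countable A -> (forall i x, 0 <= a i x)%E -> (forall i x, ~ A i -> a i x = 0%E) ->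
  (forall i, measurable_fun setT (a i)) ->
  measurable_fun setT (fun x => \esum_(i in [set: I]) a i x)%E.
Proof.
move=> cA a0 aA ma; have [g gE] := countable_esum_series cA.
rewrite (_ : (fun x => _) = fun x => (\sum_(k <oo) oapp (a ^~ x) 0 (g k))%E); last first.
  by apply/funext => x; apply: gE => // i; exact: aA.
apply: ge0_emeasurable_sum => [k x _ _|k _].
  by case: (g k) => //= i; exact: a0.
by case: (g k) => [i|] /=; [exact: ma|exact: measurable_cst].
Qed.

Lemma iint_esum n (A : set I) (a : I -> brV R n -> \bar R) :
  countable A -> (forall i x, 0 <= a i x)%E -> (forall i x, ~ A i -> a i x = 0%E) ->
  (forall i, measurable_fun setT (a i)) ->
  (iint (fun x => \esum_(i in [set: I]) a i x) = \esum_(i in [set: I]) iint (a i))%E.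
Proof.
move=> cA a0 aA ma; have [g gE] := countable_esum_series cA.
rewrite gE; last 2 first.
- by move=> i; exact: iint_ge0.
- by move=> i Ai; rewrite -[RHS](@iint_zero R n); apply: iint_eq => x; exact: aA.
transitivity (iint (fun x : brV R n => \sum_(k <oo) oapp (fun i => a i x) 0 (g k)))%E.
  by apply: iint_eq => x; apply: gE => // i; exact: aA.
rewrite (@iint_nneseries _ _ (fun k x => oapp (fun i => a i x) 0%E (g k))).
- by apply: eq_eseriesr => k _; case: (g k) => //=; exact: iint_zero.
- by move=> k; case: (g k) => [i|] /=; [exact: ma|exact: measurable_cst].
- by move=> k x; case: (g k) => [i|] /=.
Qed.
End countable_esum.

(** * Measurable and square-integrable functions on R^d *)

Section L2_theory.
Variables (R : realType) (d : nat).
Local Notation normc := (@Normc.normc R).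
Local Notation fn := (fn R d).
Local Notation tfpt := (tfpt R d).
Implicit Types (f g : fn) (l : tfpt).

(** Measurability is separated from finiteness of the norm, so that it passes to sums and products
    without integrability. *)
Definition cmeas f :=
  measurable_fun setT ((fun x => complex.Re (f x)) : brV R d -> R) /\
  measurable_fun setT ((fun x => complex.Im (f x)) : brV R d -> R).

Lemma L2P f : L2 f <-> cmeas f /\ (l2sq f < +oo)%E.
Proof.
split=> [[/borel_funP ? /borel_funP ? ?]|[[? ?] ?]] //.
by split => //; exact/borel_funP.
Qed.

Lemma cmeas_normc2 f : cmeas f ->
  measurable_fun setT ((fun x => normc (f x) ^+ 2) : brV R d -> R).
Proof.
move=> [mr mi]; under eq_fun do rewrite sqr_normc.
by apply: measurable_funD; exact: measurable_funX.
Qed.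

Lemma cmeas_l2 f : cmeas f ->
  measurable_fun setT ((fun x => (normc (f x) ^+ 2)%:E) : brV R d -> \bar R).
Proof. by move=> mf; apply/measurable_EFinP; exact: cmeas_normc2. Qed.

Lemma cmeasD f g : cmeas f -> cmeas g -> cmeas (fun x => f x + g x).
Proof.
move=> [mf1 mf2] [mg1 mg2].
by split; under eq_fun do rewrite raddfD; exact: measurable_funD.
Qed.

Lemma cmeasM f g : cmeas f -> cmeas g -> cmeas (fun x => f x * g x).
Proof.
move=> [mf1 mf2] [mg1 mg2]; split.
- rewrite (_ : (fun x => _) = fun x => complex.Re (f x) * complex.Re (g x) -
      complex.Im (f x) * complex.Im (g x)).
    by apply: measurable_funB; exact: measurable_funM.
  by apply/funext => x; case: (f x) => ? ?; case: (g x).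
- rewrite (_ : (fun x => _) = fun x => complex.Re (f x) * complex.Im (g x) +
      complex.Im (f x) * complex.Re (g x)).
    by apply: measurable_funD; exact: measurable_funM.
  by apply/funext => x; case: (f x) => ? ?; case: (g x).
Qed.

Lemma cmeas_cst (z : R[i]) : cmeas (fun=> z).
Proof. by split; exact: measurable_cst. Qed.

Lemma cmeasB f g : cmeas f -> cmeas g -> cmeas (fun x => f x - g x).
Proof.
move=> mf mg; under eq_fun do rewrite -mulN1r.
by apply: cmeasD => //; apply: cmeasM => //; exact: cmeas_cst.
Qed.

Lemma dotv_continuous (w : 'rV[R]_d) : continuous (dotv w).
Proof.
apply: (@continuous_big R _ +%R 0 xpredT _ 'rV[R]_d _
  (fun i x => w ord0 i * x ord0 i)) => [|i _ x]; first exact: add_continuous.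
by apply: continuousM; [exact: cst_continuous|exact: coord_continuous].
Qed.

Lemma cmeas_U l f : cmeas f -> cmeas (U l f).
Proof.
move=> [m1 m2]; apply: cmeasM; last first.
  by split; [exact: (measurableT_comp m1 (@brV_translation_measurable R d l.1))|
    exact: (measurableT_comp m2 (@brV_translation_measurable R d l.1))].
split; apply: (@brV_continuous_measurable R d) => x;
  apply: continuous_comp; try exact: dotv_continuous.
- exact: continuous_cos.
- exact: continuous_sin.
Qed.

Lemma cmeas_sum (J : seq tfpt) (F : tfpt -> fn) :
  (forall l, cmeas (F l)) -> cmeas (fun x => \sum_(l <- J) F l x).
Proof.
move=> mF; elim: J => [|l J IH].
  by under eq_fun do rewrite big_nil; exact: cmeas_cst.
by under eq_fun do rewrite big_cons; exact: cmeasD.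
Qed.

Lemma l2sq_ge0 f : (0 <= l2sq f)%E.
Proof. by apply: iint_ge0 => x; rewrite lee_fin sqr_ge0. Qed.

Lemma normc_sqrD (z w : R[i]) : normc (z + w) ^+ 2 <= 2 * normc z ^+ 2 + 2 * normc w ^+ 2.
Proof.
rewrite !sqr_normc; case: z => a b; case: w => a' b' /=.
have := sqr_ge0 (a - a'); have := sqr_ge0 (b - b'); rewrite !expr2; lra.
Qed.

(** The pointwise bound on |z + w|^2 stands in for Minkowski's inequality; a constant factor can be
    afforded wherever it is applied. *)
Lemma l2sqD f g : cmeas f -> cmeas g ->
  (l2sq (fun x => f x + g x)%R <= 2%:E * l2sq f + 2%:E * l2sq g)%E.
Proof.
move=> mf mg; rewrite /l2sq -!(@iintZl R d)//; try exact: cmeas_l2;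
  try by move=> x; rewrite lee_fin sqr_ge0.
have m2 h : cmeas h ->
   measurable_fun setT ((fun x => 2%:E * (normc (h x) ^+ 2)%:E)%E : brV R d -> \bar R).
  move=> mh; apply/measurable_EFinP; apply: measurable_funM; first exact: measurable_cst.
  exact: cmeas_normc2.
rewrite -(@iintD R d); try exact: m2; try by move=> x; rewrite -EFinM lee_fin mulr_ge0// sqr_ge0.
apply: (@le_iint R d).
- by apply: cmeas_l2; exact: cmeasD.
- by apply: emeasurable_funD; exact: m2.
- by move=> x; rewrite lee_fin sqr_ge0.
- by move=> x; rewrite -!EFinM -EFinD lee_fin normc_sqrD.
Qed.

Lemma l2sqB f g : cmeas f -> cmeas g ->
  (l2sq f <= 2%:E * l2sq (fun x => (f x - g x)%R) + 2%:E * l2sq g)%E.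
Proof.
move=> mf mg; have := l2sqD (cmeasB mf mg) mg.
by rewrite (_ : (fun x => f x - g x + g x) = f)//; apply/funext => x; rewrite subrK.
Qed.

Lemma l2sqC f g : l2sq (fun x => f x - g x) = l2sq (fun x => g x - f x).
Proof.
by apply: iint_eq => x; rewrite -opprB sqr_normc raddfN/= raddfN/= !sqrrN -sqr_normc.
Qed.

Lemma normc_expi (t : R) : normc (expi t) = 1.
Proof. by rewrite /= cos2Dsin2 sqrtr1. Qed.

Lemma normc_U l f x : normc (U l f x) = normc (f (x - l.1)).
Proof. by rewrite /U Normc.normcM normc_expi mul1r. Qed.

Lemma l2sq_U l f : cmeas f -> l2sq (U l f) = l2sq f.
Proof.
move=> mf; rewrite -[RHS](@iint_translation R d l.1); last 2 first.
- exact: cmeas_l2.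
- by move=> x; rewrite lee_fin sqr_ge0.
by apply: iint_eq => x; rewrite normc_U.
Qed.

Lemma L2_U l f : L2 f -> L2 (U l f).
Proof.
by move=> /L2P[mf f2]; apply/L2P; rewrite l2sq_U//; split => //; exact: cmeas_U.
Qed.
End L2_theory.

(** * Operators with summable symbol *)

Section opsum_theory.
Variables (R : realType) (d : nat).
Local Notation normc := (@Normc.normc R).
Local Notation fn := (fn R d).
Local Notation tfpt := (tfpt R d).
Implicit Types (f g : fn) (l : tfpt) (c : tfpt -> R[i]) (J : seq tfpt).

Lemma normcE_ge0 (I : Type) (a : I -> R[i]) i : (0 <= (normc (a i))%:E)%E.
Proof. by rewrite lee_fin normc_ge0. Qed.

(* Where the series defining [opsum c f x] diverges the right-hand side is infinite,
   so the bound holds with no exceptional null set. *)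
Lemma opsum_approx_pointwise c c0 J (K : R) f x :
  uniq J -> (forall l, l \notin J -> c0 l = 0) -> 0 < K ->
  (\esum_(l in [set: tfpt]) (normc (c l - c0 l))%:E <= K%:E)%E ->
  ((normc (opsum c f x - \sum_(l <- J) c0 l * U l f x) ^+ 2)%:E <=
   (2 * K)%:E * \esum_(l in [set: tfpt])
     (normc (c l - c0 l) * normc (f (x - l.1)) ^+ 2)%:E)%E.
Proof.
move=> uJ c0J K0 cK; set H := (\esum_(l in _) (_ * _)%:E)%E.
have H0 : (0 <= H)%E.
  by apply: esum_ge0 => l _; rewrite lee_fin mulr_ge0 ?normc_ge0 ?sqr_ge0.
have [Hoo|Hoo] := eqVneq H +oo%E.
  by rewrite Hoo mulry gtr0_sg ?mul1e ?leey// mulr_gt0.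
have Hfin : H \is a fin_num by rewrite ge0_fin_numE// lt_neqAle Hoo leey.
have abE l : (normc (c l * U l f x - c0 l * U l f x)) =
    normc (c l - c0 l) * normc (f (x - l.1)).
  by rewrite -mulrBl Normc.normcM normc_U.
have le_sqrt : (\esum_(l in [set: tfpt]) (normc (c l * U l f x - c0 l * U l f x))%:E
    <= (Num.sqrt (K * fine H))%:E)%E.
  apply: esum_le_seq => L uL; rewrite sumEFin lee_fin.
  under eq_bigr do rewrite abE.
  rewrite -(@ler_pXn2r _ 2)// ?nnegrE ?sqrtr_ge0//; last first.
    by apply: sumr_ge0 => l _; rewrite mulr_ge0 ?normc_ge0.
  rewrite sqr_sqrtr; last by rewrite mulr_ge0 ?fine_ge0// ltW.
  apply: le_trans (weighted_cauchy_schwarz _ _ _) _; first by move=> l; rewrite normc_ge0.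
  apply: ler_pM.
  - by apply: sumr_ge0 => l _; rewrite normc_ge0.
  - by apply: sumr_ge0 => l _; rewrite mulr_ge0 ?normc_ge0 ?sqr_ge0.
  - rewrite -lee_fin -sumEFin; apply: le_trans cK; apply: seq_le_esum => // l.
    by rewrite lee_fin normc_ge0.
  - rewrite -lee_fin fineK// -sumEFin; apply: seq_le_esum => // l.
    by rewrite lee_fin mulr_ge0 ?normc_ge0 ?sqr_ge0.
have lt_oo := le_lt_trans le_sqrt (ltry _).
have bJ l : l \notin J -> c0 l * U l f x = 0 by move=> /c0J ->; rewrite mul0r.
rewrite -(fineK Hfin) -EFinM lee_fin.
apply: le_trans (csum_approx uJ bJ lt_oo) _.
rewrite -mulrA ler_pM2l// -(@sqr_sqrtr _ (K * fine H)); last first.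
  by rewrite mulr_ge0 ?fine_ge0// ltW.
rewrite lerXn2r// ?nnegrE ?sqrtr_ge0//.
  by rewrite fine_ge0// esum_ge0// => l _; rewrite lee_fin normc_ge0.
rewrite -lee_fin fineK//.
by rewrite ge0_fin_numE// esum_ge0// => l _; rewrite lee_fin normc_ge0.
Qed.

Lemma countable_support c : (\esum_(l in [set: tfpt]) (normc (c l))%:E < +oo)%E ->
  countable [set l | c l != 0].
Proof.
move=> cfin; have := esum_countable_support (normcE_ge0 c) cfin.
apply: sub_countable; apply: subset_card_le => l /= cl0.
by apply: contra cl0 => /eqP[] /Normc.eq0_normc ->.
Qed.

(** [csum] branches on absolute convergence, so the set of points where the series converges
    absolutely must itself be measurable. All sums involved live on the countable support of [c]. *)
Lemma cmeas_opsum c f : ell1 c -> cmeas f -> cmeas (opsum c f).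
Proof.
move=> c1 mf; have cA := countable_support c1.
have mU l : cmeas (fun x => c l * U l f x) by apply: cmeasM; [exact: cmeas_cst|exact: cmeas_U].
have cl0 l : ~ [set l | c l != 0] l -> c l = 0 by move=> /negP; rewrite negbK => /eqP.
have m1 : measurable_fun setT ((fun x => \esum_(l in [set: tfpt]) (normc (c l * U l f x))%:E)%E : brV R d -> \bar R).
  apply: (esum_measurable cA) => [l x|l x /cl0 ->|l].
  - exact: normcE_ge0.
  - by rewrite mul0r Normc.normc0.
  apply/measurable_EFinP.
  rewrite (_ : (fun x => _) = fun x => Num.sqrt (normc (c l * U l f x) ^+ 2)); last first.
    by apply/funext => x; rewrite sqrtr_sqr ger0_norm ?normc_ge0.
  apply: (measurableT_comp _ (cmeas_normc2 (mU l))).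
  exact: continuous_measurable_fun (@sqrt_continuous R).
have mb : measurable_fun setT ((fun x => (\esum_(l in [set: tfpt]) (normc (c l * U l f x))%:E < +oo)%E) : brV R d -> bool).
  apply: (measurable_fun_bool true); rewrite setTI.
  rewrite (_ : _ @^-1` _ = [set x | (\esum_(l in [set: tfpt]) (normc (c l * U l f x))%:E < +oo)%E]) //.
  have := emeasurable_fun_infty_o measurableT m1 +oo%E.
  by rewrite setTI.
have mr (a : tfpt -> brV R d -> R) : (forall l, measurable_fun setT (a l)) ->
    (forall l x, c l = 0 -> a l x = 0) ->
    measurable_fun setT (fun x => rsum (a ^~ x)).
  move=> ma a0; apply: measurable_funB.
  - apply: measurableT_comp => //; apply: (esum_measurable cA) => [l x|l x /cl0 h|l].
    + by rewrite lee_fin le_max lexx orbT.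
    + by rewrite a0// maxxx.
    + by apply/measurable_EFinP; apply: measurable_maxr; [exact: ma|exact: measurable_cst].
  - apply: measurableT_comp => //; apply: (esum_measurable cA) => [l x|l x /cl0 h|l].
    + by rewrite lee_fin le_max lexx orbT.
    + by rewrite a0// oppr0 maxxx.
    + apply/measurable_EFinP; apply: measurable_maxr; last exact: measurable_cst.
      exact: (measurableT_comp _ (ma l)).
split.
- rewrite (_ : (fun x => _) = fun x => if (\esum_(l in [set: tfpt]) (normc (c l * U l f x))%:E < +oo)%E
      then rsum (fun l => complex.Re (c l * U l f x)) else 0).
    apply: measurable_fun_ifT => //.
    apply: (mr (fun l x => complex.Re (c l * U l f x))) => [l|l x ->].
      by have [] := mU l.
    by rewrite mul0r.
  by apply/funext => x; rewrite /opsum /csum; case: ifP.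
- rewrite (_ : (fun x => _) = fun x => if (\esum_(l in [set: tfpt]) (normc (c l * U l f x))%:E < +oo)%E
      then rsum (fun l => complex.Im (c l * U l f x)) else 0).
    apply: measurable_fun_ifT => //.
    apply: (mr (fun l x => complex.Im (c l * U l f x))) => [l|l x ->].
      by have [] := mU l.
    by rewrite mul0r.
  by apply/funext => x; rewrite /opsum /csum; case: ifP.
Qed.

(** A Young-type bound with two uses: it measures how well a finite symbol approximates [c], and
    with [c] = 0 it bounds the operator of the finite symbol itself. *)
Lemma opsum_approx c c0 J (K : R) f :
  ell1 c -> uniq J -> (forall l, l \notin J -> c0 l = 0) -> 0 < K ->
  (\esum_(l in [set: tfpt]) (normc (c l - c0 l))%:E <= K%:E)%E ->
  cmeas f ->
  (l2sq (fun x => (opsum c f x - \sum_(l <- J) c0 l * U l f x)%R) <=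
   (2 * K ^+ 2)%:E * l2sq f)%E.
Proof.
move=> c1 uJ c0J K0 cK mf.
have cA := @countable_support (fun l => c l - c0 l) (le_lt_trans cK (ltry _)).
pose a l (x : brV R d) := (normc (c l - c0 l) * normc (f (x - l.1)) ^+ 2)%:E.
have a0 l x : (0 <= a l x)%E by rewrite lee_fin mulr_ge0 ?normc_ge0 ?sqr_ge0.
have aE l : a l = (fun x => (normc (c l - c0 l))%:E * (normc (U l f x) ^+ 2)%:E)%E.
  by apply/funext => x; rewrite normc_U.
have ma l : measurable_fun setT (a l).
  rewrite aE; apply/measurable_EFinP; apply: measurable_funM; first exact: measurable_cst.
  by apply: cmeas_normc2; exact: cmeas_U.
have aA l x : ~ [set l | c l - c0 l != 0] l -> a l x = 0%E.
  by move=> /negP; rewrite negbK => /eqP h; rewrite /a h Normc.normc0 mul0r.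
have mH := esum_measurable cA a0 aA ma.
apply: (@le_trans _ _ (iint (fun x : brV R d => (2 * K)%:E * \esum_(l in [set: tfpt]) a l x)%E)).
  apply: (@le_iint R d) => [||x|x].
  - apply: cmeas_l2; apply: cmeasB; first exact: cmeas_opsum.
    by apply: cmeas_sum => l; apply: cmeasM; [exact: cmeas_cst|exact: cmeas_U].
  - exact: (measurable_funeM _ mH).
  - by rewrite lee_fin sqr_ge0.
  - exact: opsum_approx_pointwise.
have K20 : 0 <= 2 * K by rewrite mulr_ge0// ltW.
rewrite (@iintZl R d)//; last by move=> x; exact: esum_ge0.
(* One factor [K] comes from the pointwise Cauchy-Schwarz bound, the other from the total mass of
   [c - c0], since all the [U l f] have the same norm. *)
rewrite expr2 mulrA [in leRHS]EFinM -[leRHS]muleA; apply: lee_wpmul2l => //.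
rewrite (iint_esum cA)//; apply: esum_le_seq => L uL.
under eq_bigr => l _.
  rewrite aE (@iintZl R d) ?normc_ge0//; last 2 first.
  - by apply: cmeas_l2; exact: cmeas_U.
  - by move=> x; rewrite lee_fin sqr_ge0.
  rewrite -[iint _]/(l2sq (U l f)) l2sq_U//.
  over.
rewrite -ge0_sume_distrl; last by move=> l _; exact: normcE_ge0.
apply: lee_wpmul2r; first exact: l2sq_ge0.
by apply: le_trans cK; apply: seq_le_esum => // l; exact: normcE_ge0.
Qed.
End opsum_theory.

(** * Phases and the cocycle *)

Section phases.
Variables (R : realType) (d : nat).
Local Notation tfpt := (tfpt R d).

Lemma expiD (a b : R) : expi (a + b) = expi a * expi b.
Proof. by rewrite /expi cosD sinD; apply/eqP; rewrite eq_complex/=; apply/andP; split; apply/eqP; ring. Qed.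

Lemma expi0 : expi 0 = 1 :> R[i].
Proof. by rewrite /expi cos0 sin0. Qed.

Lemma conj_expi (a : R) : conjc (expi a) = expi (- a).
Proof. by rewrite /expi cosN sinN. Qed.

Lemma dotvDl (x y z : vec R d) : dotv (x + y) z = dotv x z + dotv y z.
Proof. by rewrite -big_split; apply: eq_bigr => i _; rewrite mxE mulrDl. Qed.

Lemma dotvDr (x y z : vec R d) : dotv x (y + z) = dotv x y + dotv x z.
Proof. by rewrite -big_split; apply: eq_bigr => i _; rewrite mxE mulrDr. Qed.

Lemma dotvNr (x y : vec R d) : dotv x (- y) = - dotv x y.
Proof. by rewrite -sumrN; apply: eq_bigr => i _; rewrite mxE mulrN. Qed.

Lemma dotvNl (x y : vec R d) : dotv (- x) y = - dotv x y.
Proof. by rewrite -sumrN; apply: eq_bigr => i _; rewrite mxE mulNr. Qed.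

Lemma dotv0l (x : vec R d) : dotv 0 x = 0.
Proof. by apply: big1 => i _; rewrite mxE mul0r. Qed.

Lemma dotv0r (x : vec R d) : dotv x 0 = 0.
Proof. by apply: big1 => i _; rewrite mxE mulr0. Qed.

(* The cocycle of the projective representation [U]: U_k U_l = sigma(k, l) U_{k + l}. *)
Definition cocycle (k l : tfpt) : R[i] := expi (- dotv l.2 k.1).

Lemma normc_cocycle k l : Normc.normc (cocycle k l) = 1.
Proof. exact: normc_expi. Qed.

(** Both sides are the phase of U_k U_l U_m. This 2-cocycle identity is what makes twisted
    convolution associative. *)
Lemma cocycleP k l m :
  cocycle k l * cocycle (k + l) m = cocycle k (l + m) * cocycle l m.
Proof. by rewrite -!expiD; congr expi; rewrite dotvDl dotvDr; ring. Qed.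

Lemma cocycle0l l : cocycle 0 l = 1.
Proof. by rewrite /cocycle dotv0r oppr0 expi0. Qed.

Lemma cocycle0r l : cocycle l 0 = 1.
Proof. by rewrite /cocycle dotv0l oppr0 expi0. Qed.

Lemma U_U k l (f : fn R d) x : U k (U l f) x = cocycle k l * U (k + l) f x.
Proof.
rewrite /U mulrA mulrA /cocycle -!expiD; congr (expi _ * f _).
  by rewrite dotvDl dotvDr dotvNr; ring.
by rewrite opprD addrA.
Qed.
End phases.

(** * The twisted group algebra *)

Section finitely_supported.
Variables (R : realType) (d : nat).
Local Notation tfpt := (tfpt R d).
Local Notation normc := (@Normc.normc R).

(** Finiteness is a proposition about the coefficient function and not a chosen list, so equal
    coefficients give equal elements and ring laws can be checked pointwise. *)
Record falg := Falg {
  fcoef :> tfpt -> R[i];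
  fcoefP : finite_set [set l | fcoef l != 0] }.

HB.instance Definition _ := gen_eqMixin falg.
HB.instance Definition _ := gen_choiceMixin falg.

Lemma falgP (f g : falg) : f =1 g -> f = g.
Proof.
case: f g => [f fP] [g gP] /= /funext fg; rewrite fg in fP *.
by congr Falg; exact: Prop_irrelevance.
Qed.

Definition fsupp (f : falg) : seq tfpt := finmap.enum_fset (fset_set [set l | f l != 0]).

Lemma fsupp_uniq f : uniq (fsupp f).
Proof. exact: finmap.fset_uniq. Qed.

Lemma mem_fsupp f l : (l \in fsupp f) = (f l != 0).
Proof.
rewrite -[LHS]/(l \in fset_set _) in_fset_set; last exact: fcoefP.
by apply/idP/idP => [/set_mem|/mem_set].
Qed.

Lemma finite_support_seq (h : tfpt -> R[i]) (J : seq tfpt) :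
  (forall l, l \notin J -> h l = 0) -> finite_set [set l | h l != 0].
Proof.
move=> hJ; apply: (@sub_finite_set _ _ [set` J]); last exact: finite_seq.
by move=> l /= hl; apply: contraNT hl => /hJ ->.
Qed.

(** Cancellation can shrink the support of a sum or product; hence sums over different lists must be
    comparable as soon as both lists contain the support. *)
Lemma sum_support (V : nmodType) (h : tfpt -> V) (J K : seq tfpt) :
  uniq J -> uniq K -> (forall l, h l != 0 -> l \in J) ->
  (forall l, h l != 0 -> l \in K) -> \sum_(l <- J) h l = \sum_(l <- K) h l.
Proof.
move=> uJ uK hJ hK.
rewrite (bigID (fun l => h l != 0))/= [X in _ + X]big1 ?addr0; last first.
  by move=> l; rewrite negbK => /eqP.
rewrite [RHS](bigID (fun l => h l != 0))/= [X in _ = _ + X]big1 ?addr0; last first.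
  by move=> l; rewrite negbK => /eqP.
rewrite -big_filter -[RHS]big_filter; apply: perm_big.
apply: uniq_perm; rewrite ?filter_uniq// => l; rewrite !mem_filter.
by case: eqP => //= /eqP h0; rewrite hJ ?hK.
Qed.

Lemma sum_fsupp (V : nmodType) (f : falg) (h : tfpt -> V) (J : seq tfpt) :
  uniq J -> (forall l, f l = 0 -> h l = 0) -> (forall l, f l != 0 -> l \in J) ->
  \sum_(l <- fsupp f) h l = \sum_(l <- J) h l.
Proof.
move=> uJ fh fJ; have hf l : h l != 0 -> f l != 0 by apply: contra => /eqP /fh ->.
apply: sum_support => //; first exact: fsupp_uniq.
- by move=> l /hf; rewrite mem_fsupp.
- by move=> l /hf /fJ.
Qed.

Fact fadd_finite (f g : falg) : finite_set [set l | f l + g l != 0].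
Proof.
apply: (@finite_support_seq _ (fsupp f ++ fsupp g)) => l.
by rewrite mem_cat !mem_fsupp negb_or !negbK => /andP[/eqP -> /eqP ->]; rewrite addr0.
Qed.
Definition fadd f g := Falg (fadd_finite f g).

Fact fopp_finite (f : falg) : finite_set [set l | - f l != 0].
Proof.
apply: (@finite_support_seq _ (fsupp f)) => l.
by rewrite mem_fsupp negbK => /eqP ->; rewrite oppr0.
Qed.
Definition fopp f := Falg (fopp_finite f).

Fact mono_finite (a : R[i]) (k : tfpt) : finite_set [set l | (if l == k then a else 0) != 0].
Proof.
by apply: (@finite_support_seq _ [:: k]) => l; rewrite inE => /negbTE ->.
Qed.
Definition mono a k := Falg (mono_finite a k).

Lemma monoE a k l : mono a k l = if l == k then a else 0.
Proof. by []. Qed.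

Lemma sum_mono (V : nmodType) a k (h : tfpt -> V) : (a = 0 -> h k = 0) ->
  \sum_(l <- fsupp (mono a k)) (if l == k then h l else 0) = h k.
Proof.
move=> ah; rewrite (@sum_fsupp _ _ _ [:: k])//.
- by rewrite big_seq1 eqxx.
- by move=> l; rewrite monoE; case: (l =P k) => // -> /ah.
- by move=> l; rewrite monoE inE; case: (l =P k) => //; rewrite eqxx.
Qed.

Definition conv_fun (f g : tfpt -> R[i]) (J : seq tfpt) m :=
  \sum_(k <- J) f k * cocycle k (m - k) * g (m - k).

Definition sumset (J K : seq tfpt) := undup [seq k + l | k <- J, l <- K].

Fact fmul_finite (f g : falg) :
  finite_set [set m | conv_fun f g (fsupp f) m != 0].
Proof.
apply: (@finite_support_seq _ (sumset (fsupp f) (fsupp g))) => m mn.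
rewrite /conv_fun big_seq big1// => k kf.
have [->|gn0] := eqVneq (g (m - k)) 0; first by rewrite mulr0.
case/negP: mn; rewrite mem_undup; apply/allpairsP; exists (k, m - k).
by rewrite /= kf mem_fsupp gn0 addrC subrK.
Qed.
Definition fmul (f g : falg) := Falg (fmul_finite f g).

Lemma fmulE (f g : falg) m : fmul f g m = \sum_(k <- fsupp f) f k * cocycle k (m - k) * g (m - k).
Proof. by []. Qed.

Lemma fmul_supp (f g : falg) m : fmul f g m != 0 -> m \in sumset (fsupp f) (fsupp g).
Proof.
apply: contraNT => mn; rewrite fmulE big_seq big1// => k kf.
have [->|gn0] := eqVneq (g (m - k)) 0; first by rewrite mulr0.
case/negP: mn; rewrite mem_undup; apply/allpairsP; exists (k, m - k).
by rewrite /= kf mem_fsupp gn0 addrC subrK.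
Qed.

(** Pairing with an arbitrary [phi] serves several purposes: associativity ([fmulA]),
    multiplicativity of the representation ([TfM]) and the adjoint formula ([inner_adjoint]) are
    special choices of [phi]. *)
Lemma sum_fmul (f g : falg) (phi : tfpt -> R[i]) :
  \sum_(m <- fsupp (fmul f g)) fmul f g m * phi m =
  \sum_(k <- fsupp f) \sum_(l <- fsupp g) f k * g l * (cocycle k l * phi (k + l)).
Proof.
rewrite (@sum_fsupp _ _ _ (sumset (fsupp f) (fsupp g))); last 3 first.
- exact: undup_uniq.
- by move=> m ->; rewrite mul0r.
- exact: fmul_supp.
under eq_bigr do rewrite fmulE mulr_suml.
rewrite exchange_big/=; apply: eq_big_seq => k kf.
pose h m := f k * cocycle k (m - k) * g (m - k) * phi m.
rewrite (@sum_support _ h _ [seq k + l | l <- fsupp g]); last 4 first.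
- exact: undup_uniq.
- by rewrite map_inj_uniq ?fsupp_uniq//; exact: addrI.
- move=> m hm; rewrite mem_undup; apply/allpairsP; exists (k, m - k).
  rewrite /= kf mem_fsupp [k + _]addrC subrK; split=> //.
  by apply: contra hm => /eqP g0; rewrite /h g0 mulr0 mul0r.
- move=> m hm; apply/mapP; exists (m - k); last by rewrite [k + _]addrC subrK.
  rewrite mem_fsupp.
  by apply: contra hm => /eqP g0; rewrite /h g0 mulr0 mul0r.
rewrite big_map; apply: eq_bigr => l _.
by rewrite /h [k + l]addrC addrK; ring.
Qed.

Fact faddA : associative fadd.
Proof. by move=> f g h; apply: falgP => l /=; rewrite addrA. Qed.
Fact faddC : commutative fadd.
Proof. by move=> f g; apply: falgP => l /=; rewrite addrC. Qed.
Fact fadd0 : left_id (mono 0 0) fadd.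
Proof. by move=> f; apply: falgP => l /=; rewrite if_same add0r. Qed.
Fact faddN : left_inverse (mono 0 0) fopp fadd.
Proof. by move=> f; apply: falgP => l /=; rewrite if_same addNr. Qed.

HB.instance Definition _ := GRing.isZmodule.Build falg faddA faddC fadd0 faddN.

Lemma fcoefD (f g : falg) l : fcoef (f + g) l = f l + g l. Proof. by []. Qed.
Lemma fcoefN (f : falg) l : fcoef (- f) l = - f l. Proof. by []. Qed.
Lemma fcoef0 l : fcoef 0 l = 0. Proof. by rewrite /=; case: ifP. Qed.

Fact fmulA : associative fmul.
Proof.
move=> f g h; apply: falgP => m; rewrite !fmulE.
transitivity (\sum_(k <- fsupp f) \sum_(l <- fsupp g)
  f k * g l * (cocycle k l * (cocycle (k + l) (m - (k + l)) * h (m - (k + l))))).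
  apply: eq_bigr => k _; rewrite fmulE mulr_sumr; apply: eq_bigr => l _.
  have cE := cocycleP k l (m - k - l).
  rewrite [l + _]addrC subrK in cE.
  by rewrite opprD addrA [cocycle k l * _]mulrA cE; ring.
rewrite -(sum_fmul f g (fun p => cocycle p (m - p) * h (m - p))).
by apply: eq_bigr => p _; rewrite mulrA.
Qed.

Fact fmul1l : left_id (mono 1 0) fmul.
Proof.
move=> f; apply: falgP => m; rewrite fmulE.
rewrite -[RHS](@sum_mono _ 1 0 (fun=> f m)) => [|/eqP]; last by rewrite oner_eq0.
apply: eq_bigr => l _; rewrite monoE; case: eqP => [->|]; last by rewrite !mul0r.
by rewrite cocycle0l !mul1r subr0.
Qed.

Fact fmul1r : right_id (mono 1 0) fmul.
Proof.
move=> f; apply: falgP => m; rewrite fmulE.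
have [fm0|fm0] := eqVneq (f m) 0.
  rewrite fm0 big1// => l _; rewrite monoE; case: eqP => [/subr0_eq ml|]; last by rewrite mulr0.
  by rewrite -ml fm0 !mul0r.
rewrite (@sum_support _ (fun k => f k * cocycle k (m - k) * mono 1 0 (m - k)) _ [:: m]); last 4 first.
- exact: fsupp_uniq.
- by [].
- move=> l; rewrite mem_fsupp; apply: contra => /eqP ->; by rewrite !mul0r.
- move=> l; rewrite monoE inE; case: (m - l =P 0) => [/subr0_eq ->|]; first by rewrite eqxx.
  by rewrite mulr0 eqxx.
by rewrite big_seq1 subrr monoE eqxx cocycle0r !mulr1.
Qed.

Fact fmulDl : left_distributive fmul fadd.
Proof.
move=> f g h; apply: falgP => m; rewrite [RHS]/= !fmulE /conv_fun.
pose J := undup (fsupp f ++ fsupp g).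
have uJ : uniq J by exact: undup_uniq.
rewrite (@sum_fsupp _ _ _ J)//; first last.
- move=> l fgl; rewrite mem_undup mem_cat !mem_fsupp -negb_and.
  by apply: contra fgl => /andP[/eqP fl /eqP gl]; rewrite /= fl gl addr0.
- by move=> l ->; rewrite !mul0r.
rewrite (@sum_fsupp _ f _ J)//; first last.
- by move=> l fl; rewrite mem_undup mem_cat !mem_fsupp fl.
- by move=> l ->; rewrite !mul0r.
rewrite (@sum_fsupp _ g _ J)//; first last.
- by move=> l gl; rewrite mem_undup mem_cat !mem_fsupp gl orbT.
- by move=> l ->; rewrite !mul0r.
by rewrite -big_split; apply: eq_bigr => l _; rewrite /= !mulrDl.
Qed.

Fact fmulDr : right_distributive fmul fadd.
Proof.
move=> f g h; apply: falgP => m; rewrite [RHS]/= !fmulE /conv_fun.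
by rewrite -big_split; apply: eq_bigr => l _; rewrite /= mulrDr.
Qed.

Fact fone_neq0 : mono 1 0 != 0.
Proof.
apply/eqP => /(congr1 (fun f : falg => f 0)); rewrite monoE eqxx fcoef0.
by move/eqP; rewrite oner_eq0.
Qed.

HB.instance Definition _ := GRing.Zmodule_isNzRing.Build falg
  fmulA fmul1l fmul1r fmulDl fmulDr fone_neq0.

Lemma fcoefM (f g : falg) m :
  fcoef (f * g) m = \sum_(k <- fsupp f) f k * cocycle k (m - k) * g (m - k).
Proof. by []. Qed.

Lemma fcoef1 m : fcoef 1 m = if m == 0 then 1 else 0.
Proof. by []. Qed.

Lemma monoM a k (f : falg) m : fcoef (mono a k * f) m = a * cocycle k (m - k) * f (m - k).
Proof.
rewrite fcoefM -[RHS](@sum_mono _ a k (fun k => a * cocycle k (m - k) * f (m - k))); last first.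
  by move=> ->; rewrite !mul0r.
by apply: eq_bigr => l _; rewrite monoE; case: eqP => //; rewrite !mul0r.
Qed.

Lemma falg_sum_mono (f : falg) : f = \sum_(k <- fsupp f) mono (f k) k.
Proof.
have fcoef_sum (J : seq tfpt) (F : tfpt -> falg) l : (\sum_(k <- J) F k) l = \sum_(k <- J) F k l.
  by elim: J => [|k J IH]; rewrite ?big_nil ?fcoef0// !big_cons fcoefD IH.
apply: falgP => l; rewrite fcoef_sum.
have [fl|fl] := eqVneq (f l) 0.
  by rewrite fl big1// => k _; rewrite monoE; case: eqP => // <-.
rewrite (@sum_support _ (fun k => mono (f k) k l) _ [:: l]) ?fsupp_uniq//.
- by rewrite big_seq1 monoE eqxx.
- move=> k; rewrite monoE mem_fsupp; case: (l =P k) => [//|]; by rewrite eqxx.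
- move=> k; rewrite monoE inE [k == l]eq_sym; case: (l =P k) => //; by rewrite eqxx.
Qed.

Definition Tf (g : falg) (f : fn R d) : fn R d := fun x => \sum_(k <- fsupp g) g k * U k f x.

Lemma Tf_J (g : falg) J f x : uniq J -> (forall l, g l != 0 -> l \in J) ->
  Tf g f x = \sum_(k <- J) g k * U k f x.
Proof. by move=> uJ gJ; apply: sum_fsupp => // l ->; rewrite mul0r. Qed.

Lemma TfM (g h : falg) f : Tf (g * h) f = Tf g (Tf h f).
Proof.
apply/funext => x; rewrite /Tf (sum_fmul g h (fun m => U m f x)).
apply: eq_bigr => k _; rewrite /U !mulr_sumr; apply: eq_bigr => l _.
by rewrite -U_U /U; ring.
Qed.

Lemma TfD (g h : falg) f x : Tf (g + h) f x = Tf g f x + Tf h f x.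
Proof.
pose J := undup (fsupp g ++ fsupp h).
have uJ : uniq J by exact: undup_uniq.
rewrite !(@Tf_J _ J)//; first last.
- move=> l fgl; rewrite mem_undup mem_cat !mem_fsupp -negb_and.
  by apply: contra fgl => /andP[/eqP fl /eqP gl]; rewrite /= fl gl addr0.
- by move=> l fl; rewrite mem_undup mem_cat !mem_fsupp fl.
- by move=> l fl; rewrite mem_undup mem_cat !mem_fsupp fl orbT.
by rewrite -big_split; apply: eq_bigr => l _; rewrite /= mulrDl.
Qed.

Lemma TfN (g : falg) f x : Tf (- g) f x = - Tf g f x.
Proof.
apply/eqP; rewrite -addr_eq0 -TfD addNr /Tf big1// => l _.
by rewrite fcoef0 mul0r.
Qed.

Lemma Tf1 f x : Tf 1 f x = f x.
Proof.
rewrite (@Tf_J _ [:: 0])//; first last.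
  by move=> l; rewrite fcoef1 inE; case: (l =P 0) => //; rewrite eqxx.
by rewrite big_seq1 fcoef1 eqxx /U dotv0l expi0 !mul1r subr0.
Qed.

Lemma TfBr (g : falg) f f' x : Tf g (fun x => f x - f' x) x = Tf g f x - Tf g f' x.
Proof. by rewrite /Tf -sumrB; apply: eq_bigr => l _; rewrite /U -!mulrBr. Qed.

Lemma cmeas_Tf (g : falg) f : cmeas f -> cmeas (Tf g f).
Proof.
move=> mf; apply: cmeas_sum => l; apply: cmeasM; last exact: cmeas_U.
exact: cmeas_cst.
Qed.
End finitely_supported.

(** * The weighted l^1 norm and the l^2 norm *)

Section norms.
Variables (R : realType) (d : nat).
Local Notation tfpt := (tfpt R d).
Local Notation normc := (@Normc.normc R).
Local Notation falg := (falg R d).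

Implicit Types (f g h : falg).

Definition wnorm (v : tfpt -> R) (f : falg) : R := \sum_(l <- fsupp f) v l * normc (f l).
Definition l2norm2 (f : falg) : R := \sum_(l <- fsupp f) normc (f l) ^+ 2.

Lemma ler_sum_fsupp (f : falg) (h : tfpt -> R) (J : seq tfpt) : uniq J ->
  (forall l, 0 <= h l) -> (forall l, f l = 0 -> h l = 0) ->
  \sum_(l <- J) h l <= \sum_(l <- fsupp f) h l.
Proof.
move=> uJ h0 fh; pose K := undup (J ++ fsupp f).
have uK : uniq K by exact: undup_uniq.
rewrite (@sum_fsupp _ _ _ f h K)//; last first.
  by move=> l fl; rewrite mem_undup mem_cat mem_fsupp fl orbT.
have -> : \sum_(l <- J) h l = \sum_(l <- K | l \in J) h l.
  rewrite -[RHS]big_filter; apply: perm_big; apply: uniq_perm => //.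
    by rewrite filter_uniq.
  by move=> l; rewrite mem_filter mem_undup mem_cat; case: (l \in J).
by rewrite [leRHS](bigID (mem J))/= lerDl sumr_ge0.
Qed.

Lemma normcD_le (z w : R[i]) : normc (z + w) <= normc z + normc w.
Proof. exact: le_normcD. Qed.

Lemma normc_sum (I : Type) (J : seq I) (F : I -> R[i]) :
  normc (\sum_(i <- J) F i) <= \sum_(i <- J) normc (F i).
Proof.
elim: J => [|i J IH]; first by rewrite !big_nil Normc.normc0.
by rewrite !big_cons; apply: le_trans (normcD_le _ _) _; rewrite lerD2l.
Qed.

Lemma normc_fmul_le (f g : falg) m :
  normc ((f * g) m) <= \sum_(k <- fsupp f) normc (f k) * normc (g (m - k)).
Proof.
rewrite fcoefM; apply: le_trans (normc_sum _ _) _; apply: ler_sum => k _.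
by rewrite !Normc.normcM normc_cocycle mulr1.
Qed.

Lemma l2norm2_ge0 f : 0 <= l2norm2 f.
Proof. by apply: sumr_ge0 => l _; rewrite sqr_ge0. Qed.

Lemma l2norm2_J (f : falg) J : uniq J -> (forall l, f l != 0 -> l \in J) ->
  l2norm2 f = \sum_(l <- J) normc (f l) ^+ 2.
Proof. by move=> uJ fJ; apply: sum_fsupp => // l ->; rewrite Normc.normc0 expr0n. Qed.

Lemma uniq_shift (J : seq tfpt) (k : tfpt) : uniq J -> uniq [seq m - k | m <- J].
Proof. by move=> uJ; rewrite map_inj_uniq//; exact: addIr. Qed.

(** Young's inequality for l^1 acting on l^2, by Cauchy-Schwarz with weights |f(k)|. As v >= 1, the
    weighted norm dominates the plain l^1 norm. *)
Lemma l2norm2M_le (v : tfpt -> R) (f g : falg) : (forall l, 1 <= v l) ->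
  l2norm2 (f * g) <= wnorm v f ^+ 2 * l2norm2 g.
Proof.
move=> v1; pose N := \sum_(k <- fsupp f) normc (f k).
have N0 : 0 <= N by apply: sumr_ge0 => k _; rewrite normc_ge0.
have Nv : N <= wnorm v f by apply: ler_sum => k _; rewrite ler_peMl ?normc_ge0.
apply: (@le_trans _ _ (N ^+ 2 * l2norm2 g)); last first.
  by rewrite ler_wpM2r ?l2norm2_ge0// lerXn2r ?nnegrE ?(le_trans N0).
apply: (@le_trans _ _ (\sum_(m <- fsupp (f * g)) N * \sum_(k <- fsupp f) normc (f k) * normc (g (m - k)) ^+ 2)).
  apply: ler_sum => m _.
  apply: le_trans (weighted_cauchy_schwarz _ _ _); last by move=> k; rewrite normc_ge0.
  rewrite lerXn2r ?nnegrE ?normc_ge0 ?normc_fmul_le//.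
  by apply: sumr_ge0 => k _; rewrite mulr_ge0 ?normc_ge0.
rewrite -mulr_sumr expr2 -mulrA ler_wpM2l// exchange_big/= mulr_suml.
apply: ler_sum => k _; rewrite -mulr_sumr ler_wpM2l ?normc_ge0//.
rewrite -(big_map (fun m => m - k) xpredT (fun m => normc (g m) ^+ 2)).
apply: ler_sum_fsupp; first by rewrite uniq_shift ?fsupp_uniq.
- by move=> l; rewrite sqr_ge0.
- by move=> l ->; rewrite Normc.normc0 expr0n.
Qed.

Lemma l2norm2_mono (a : R[i]) k (f : falg) :
  l2norm2 (mono a k * f) = normc a ^+ 2 * l2norm2 f.
Proof.
rewrite (@l2norm2_J _ [seq k + l | l <- fsupp f]); last 2 first.
- by rewrite map_inj_uniq ?fsupp_uniq//; exact: addrI.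
- move=> m mf; apply/mapP; exists (m - k); last by rewrite [k + _]addrC subrK.
  rewrite mem_fsupp; apply: contra mf => /eqP fm.
  by rewrite monoM fm mulr0.
rewrite big_map mulr_sumr; apply: eq_bigr => l _.
by rewrite monoM [k + l]addrC addrK !Normc.normcM normc_cocycle mulr1 exprMn.
Qed.

(** * Growth of powers under subexponential weights *)

Section weight.
Variable v : tfpt -> R.
Hypothesis v_1 : v 0 = 1.
Hypothesis v_ge1 : forall l, 1 <= v l.
Hypothesis v_sub : forall l m, v (l + m) <= v l * v m.
Local Notation "'`N' f" := (wnorm v f) (at level 10, f at level 9).

Let v_ge0 l : 0 <= v l. Proof. exact: le_trans (v_ge1 l). Qed.

Lemma wnorm_ge0 f : 0 <= `N f.
Proof. by apply: sumr_ge0 => l _; rewrite mulr_ge0 ?normc_ge0. Qed.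

Lemma wnorm_J (f : falg) J : uniq J -> (forall l, f l != 0 -> l \in J) ->
  `N f = \sum_(l <- J) v l * normc (f l).
Proof. by move=> uJ fJ; apply: sum_fsupp => // l ->; rewrite Normc.normc0 mulr0. Qed.

Lemma wnorm0 : `N 0 = 0.
Proof. by apply: big1 => l _; rewrite fcoef0 Normc.normc0 mulr0. Qed.

Lemma wnormD f g : `N (f + g) <= `N f + `N g.
Proof.
pose J := undup (fsupp f ++ fsupp g).
have uJ : uniq J by exact: undup_uniq.
have fJ l : f l != 0 -> l \in J by move=> fl; rewrite mem_undup mem_cat !mem_fsupp fl.
have gJ l : g l != 0 -> l \in J by move=> gl; rewrite mem_undup mem_cat !mem_fsupp gl orbT.
have fgJ l : (f + g) l != 0 -> l \in J.
  move=> fgl; rewrite mem_undup mem_cat !mem_fsupp -negb_and.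
  by apply: contra fgl => /andP[/eqP fl /eqP gl]; rewrite fcoefD fl gl addr0.
rewrite (wnorm_J uJ fgJ) (wnorm_J uJ fJ) (wnorm_J uJ gJ).
rewrite -big_split; apply: ler_sum => l _.
by rewrite /= -mulrDr ler_wpM2l// normcD_le.
Qed.

Lemma normc_opp (z : R[i]) : normc (- z) = normc z.
Proof. by case: z => x y /=; rewrite !sqrrN. Qed.

Lemma wnormN f : `N (- f) = `N f.
Proof.
rewrite (@wnorm_J (- f) (fsupp f)) ?fsupp_uniq//; last first.
  by move=> l; rewrite fcoefN oppr_eq0 mem_fsupp.
by apply: eq_bigr => l _; rewrite fcoefN normc_opp.
Qed.

Lemma normc_le_wnorm f l : normc (f l) <= `N f.
Proof.
apply: (@le_trans _ _ (v l * normc (f l))); first by rewrite ler_peMl ?normc_ge0.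
rewrite -[leLHS](big_seq1 +%R l (fun l => v l * normc (f l))).
apply: ler_sum_fsupp => //.
- by move=> k; rewrite mulr_ge0 ?normc_ge0.
- by move=> k ->; rewrite Normc.normc0 mulr0.
Qed.

Lemma wnormM f g : `N (f * g) <= `N f * `N g.
Proof.
apply: (@le_trans _ _ (\sum_(m <- fsupp (f * g)) \sum_(k <- fsupp f)
   (v k * normc (f k)) * (v (m - k) * normc (g (m - k))))).
  apply: ler_sum => m _; apply: (@le_trans _ _ (v m * \sum_(k <- fsupp f) normc (f k) * normc (g (m - k)))).
    by rewrite ler_wpM2l// normc_fmul_le.
  rewrite mulr_sumr; apply: ler_sum => k _.
  rewrite mulrACA ler_wpM2r// ?mulr_ge0 ?normc_ge0//.
  by have := v_sub k (m - k); rewrite [k + _]addrC subrK.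
rewrite exchange_big/= mulr_suml; apply: ler_sum => k _.
rewrite -mulr_sumr ler_wpM2l ?mulr_ge0 ?normc_ge0//.
rewrite -(big_map (fun m => m - k) xpredT (fun m => v m * normc (g m))).
apply: ler_sum_fsupp; first by rewrite uniq_shift ?fsupp_uniq.
- by move=> l; rewrite mulr_ge0 ?normc_ge0.
- by move=> l ->; rewrite Normc.normc0 mulr0.
Qed.

(** Multiplicities are bounded one at a time and not by their total: this gives a recursion over [L]
    and a product count, at the cost of harmless extra points and repetitions. *)
Fixpoint box (L : seq tfpt) (n : nat) : seq tfpt :=
  if L is l :: L' then [seq l *+ k + m | k <- iota 0 n.+1, m <- box L' n] else [:: 0].

Lemma size_box L n : size (box L n) = (n.+1 ^ size L)%N.
Proof.
elim: L => [//|l L IH].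
by rewrite [box _ _]/(allpairs _ _ _) size_allpairs size_iota IH expnS.
Qed.

Lemma mem_box l L n m : reflect
  (exists k p, [/\ (k <= n)%N, p \in box L n & m = l *+ k + p])
  (m \in box (l :: L) n).
Proof.
apply: (iffP allpairsP) => [[[k p] [+ pL ->]]|[k [p [kn pL ->]]]].
  by rewrite mem_iota add0n ltnS => /andP[_ kn]; exists k, p.
by exists (k, p); rewrite mem_iota add0n ltnS.
Qed.

Lemma mem0_box L n : 0 \in box L n.
Proof.
elim: L => [|l L IH]; first by rewrite inE.
by apply/mem_box; exists 0%N, 0; rewrite mulr0n addr0.
Qed.

Lemma box_incr L n m : m \in box L n -> m \in box L n.+1.
Proof.
elim: L m => [|l L IH] m //= /mem_box[k [p [kn pL ->]]].
by apply/mem_box; exists k, p; split => //; [exact: ltnW|exact: IH].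
Qed.

(** Commutativity of R^{2d} enters here: the new summand moves next to its own multiple and raises
    only that multiplicity. *)
Lemma box_add L n l m : l \in L -> m \in box L n -> l + m \in box L n.+1.
Proof.
elim: L m => [|l' L IH] m //; rewrite inE => /orP[/eqP ->|lL].
  move=> /mem_box[k [p [kn pL ->]]]; apply/mem_box; exists k.+1, p.
  by split; [|exact: box_incr|rewrite addrA mulrS].
move=> /mem_box[k [p [kn pL ->]]]; apply/mem_box; exists k, (l + p).
by split; [exact: ltnW|exact: IH|rewrite addrCA].
Qed.

(** The Gelfand-Raikov-Shilov condition along one ray, in a form valid for all n; the constant may
    depend on [l] and [t]. *)
Hypothesis v_GRS : forall l (t : R), 1 < t ->
  exists C, forall n, v (l *+ n) <= C * t ^+ n.

Lemma sqrt_gt1 (t : R) : 1 < t -> 1 < Num.sqrt t.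
Proof. by move=> t1; rewrite -[ltLHS]sqrtr1 ltr_sqrt// (lt_trans ltr01). Qed.

Lemma sqrtX2 (t : R) n : 0 <= t -> Num.sqrt t ^+ n * Num.sqrt t ^+ n = t ^+ n.
Proof. by move=> t0; rewrite -exprMn -expr2 sqr_sqrtr. Qed.

Lemma box_weight L (t : R) : 1 < t ->
  exists2 C, 0 <= C & forall n m, m \in box L n -> v m <= C * t ^+ n.
Proof.
elim: L t => [|l L IH] t t1.
  exists 1 => // n m; rewrite inE => /eqP ->; rewrite v_1 mul1r.
  by rewrite exprn_ege1// ltW.
(* The rate is split as sqrt t * sqrt t, one factor for the multiple of [l] and one for the box of
   the remaining generators. *)
have [C1 HC1] := v_GRS l (sqrt_gt1 t1).
have [C2 C20 HC2] := IH _ (sqrt_gt1 t1).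
have C10 : 0 <= C1 by have := HC1 0%N; rewrite mulr0n v_1 mulr1; apply: le_trans.
exists (C1 * C2); first by rewrite mulr_ge0.
move=> n m /mem_box[k [p [kn pL ->]]].
apply: le_trans (v_sub _ _) _.
rewrite -(@sqrtX2 t n) ?(ltW (lt_trans ltr01 t1))// mulrACA ler_pM ?HC2//.
apply: le_trans (HC1 k) _; rewrite ler_wpM2l// ler_eXn2l//; exact: sqrt_gt1.
Qed.

Lemma natr_le_exp (t : R) : 1 < t -> exists2 C, 0 <= C & forall n, n.+1%:R <= C * t ^+ n.
Proof.
move=> t1; have t0 : 0 < t - 1 by rewrite subr_gt0.
(* Bernoulli's inequality gives n <= (t - 1)^-1 * t^n; the summand 1 pays for the successor. *)
exists (1 + (t - 1)^-1); first by rewrite addr_ge0// invr_ge0 ltW.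
have bern n : 1 + n%:R * (t - 1) <= t ^+ n.
  elim: n => [|n IH]; first by rewrite mul0r addr0 expr0.
  have T1 : 0 <= t ^+ n - 1 by rewrite subr_ge0 exprn_ege1// ltW.
  have := mulr_ge0 (ltW t0) T1; rewrite exprS -natr1; move: IH; lra.
move=> n; rewrite mulrDl mul1r -natr1 addrC lerD//.
  by rewrite exprn_ege1// ltW.
rewrite mulrC ler_pdivlMr//; apply: le_trans (bern n); lra.
Qed.

Lemma natrX_le_exp K (t : R) : 1 < t ->
  exists2 C, 0 <= C & forall n, (n.+1 ^ K)%:R <= C * t ^+ n.
Proof.
elim: K t => [|K IH] t t1.
  by exists 1 => // n; rewrite expn0 mul1r exprn_ege1// ltW.
have [C1 C10 HC1] := natr_le_exp (sqrt_gt1 t1).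
have [C2 C20 HC2] := IH _ (sqrt_gt1 t1).
exists (C1 * C2); first by rewrite mulr_ge0.
move=> n; rewrite expnS natrM -(@sqrtX2 t n) ?(ltW (lt_trans ltr01 t1))//.
by rewrite mulrACA ler_pM.
Qed.

(* [piece L n kappa f]: f is a sum of pieces f_i supported in l_i + box L n with
   sum_i v(l_i) ||f_i||_2 <= kappa. *)
Inductive piece (L : seq tfpt) (n : nat) : R -> falg -> Prop :=
| piece0 : piece L n 0 0
| piece_cons l kappa k f g :
    (forall m, f m != 0 -> m - l \in box L n) ->
    v l * Num.sqrt (l2norm2 f) <= k ->
    piece L n kappa g -> piece L n (k + kappa) (f + g).

Lemma pieceD L n k1 k2 f g : piece L n k1 f -> piece L n k2 g -> piece L n (k1 + k2) (f + g).
Proof.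
move=> pf pg; elim: pf => [|l kappa k f' g' h1 h2 h3 IH]; first by rewrite !add0r.
by rewrite -!addrA; apply: piece_cons h1 h2 IH.
Qed.

Lemma piece_le L n k1 k2 f : k1 <= k2 -> piece L n k1 f -> piece L n k2 f.
Proof.
move=> k12 pf.
have p0 : piece L n (k2 - k1) 0.
  rewrite -[X in piece _ _ X]addr0 -[X in piece _ _ _ X]addr0.
  apply: (@piece_cons L n 0 0 (k2 - k1)); last exact: piece0.
  - by move=> m; rewrite fcoef0 eqxx.
  - rewrite /l2norm2 big1 ?sqrtr0 ?mulr0 ?subr_ge0// => l _.
    by rewrite fcoef0 Normc.normc0 expr0n.
by have := pieceD pf p0; rewrite addrC subrK addr0.
Qed.

Lemma piece1 L : piece L 0 1 1.
Proof.
rewrite -[X in piece _ _ X]addr0 -[X in piece _ _ _ X]addr0.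
apply: (@piece_cons L 0 0 0 1); last exact: piece0.
- move=> m; rewrite fcoef1; case: (m =P 0) => [->|]; last by rewrite eqxx.
  by rewrite subr0 mem0_box.
- rewrite (@l2norm2_J _ [:: 0])//; last first.
    by move=> l; rewrite fcoef1 inE; case: (l =P 0) => //; rewrite eqxx.
  by rewrite big_seq1 fcoef1 eqxx Normc.normc1 expr1n sqrtr1 v_1 mulr1.
Qed.

(** The fixed factor [b] shrinks each piece in l^2 by [q] and only widens the box; the base points,
    and with them the weights v(l), stay put. *)
Lemma piece_mul_fixed (b : falg) (q : R) L n kappa f :
  0 <= q -> (forall l, b l != 0 -> l \in L) ->
  (forall f, l2norm2 (b * f) <= q ^+ 2 * l2norm2 f) ->
  piece L n kappa f -> piece L n.+1 (q * kappa) (b * f).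
Proof.
move=> q0 bL bq; elim=> [|l ka k f' g' h1 h2 h3 IH]; first by rewrite !mulr0; exact: piece0.
rewrite !mulrDr; apply: (@piece_cons _ _ l) => //.
- move=> m /fmul_supp; rewrite mem_undup => /allpairsP[[i j] /= [ib jf ->]].
  rewrite -addrA box_add//; first by rewrite bL// -mem_fsupp.
  by rewrite h1// -mem_fsupp.
- apply: le_trans (ler_wpM2l q0 h2).
  rewrite mulrCA ler_wpM2l//.
  have -> : q * Num.sqrt (l2norm2 f') = Num.sqrt (q ^+ 2 * l2norm2 f').
    by rewrite sqrtrM ?sqr_ge0// sqrtr_sqr ger0_norm.
  by rewrite ler_wsqrtr.
Qed.

(** A monomial acts on l^2 as a scaled isometry that translates supports. The shift goes into the
    base point, at the price v(p), so the box need not know about [p]. *)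
Lemma piece_mono (a : R[i]) p L n kappa f :
  piece L n kappa f -> piece L n.+1 (v p * normc a * kappa) (mono a p * f).
Proof.
elim=> [|l ka k f' g' h1 h2 h3 IH]; first by rewrite !mulr0; exact: piece0.
rewrite !mulrDr; apply: (@piece_cons _ _ (p + l)) => //.
- move=> m; rewrite monoM => mf; apply: box_incr; rewrite opprD addrA; apply: h1.
  by apply: contra mf => /eqP ->; rewrite mulr0.
- rewrite l2norm2_mono sqrtrM ?sqr_ge0// sqrtr_sqr ger0_norm ?normc_ge0//.
  apply: (@le_trans _ _ (v p * v l * (normc a * Num.sqrt (l2norm2 f')))).
    by rewrite ler_wpM2r ?mulr_ge0 ?normc_ge0 ?sqrtr_ge0.
  by rewrite mulrACA ler_wpM2l ?mulr_ge0 ?normc_ge0.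
Qed.

(** After splitting [rho] into monomials its support never reaches the box; only its norm is felt,
    which makes the later constant independent of [rho]. *)
Lemma piece_mul_any (rho : falg) L n kappa f :
  piece L n kappa f -> piece L n.+1 (`N rho * kappa) (rho * f).
Proof.
move=> pf; rewrite [X in piece _ _ _ (X * _)]falg_sum_mono !mulr_suml.
elim: (fsupp rho) => [|k J IH]; first by rewrite !big_nil; exact: piece0.
by rewrite !big_cons; apply: pieceD => //; exact: piece_mono.
Qed.

(** On l + box, v(m) <= v(l) v(m - l) with a subexponential second factor, and Cauchy-Schwarz
    against the number of points turns the l^2 norm into an l^1 norm. *)
Lemma piece_wnorm L (t : R) : 1 < t -> exists2 C, 0 <= C &
  forall n kappa f, piece L n kappa f -> `N f <= C * t ^+ n * kappa.
Proof.
move=> t1; have [C1 C10 HC1] := box_weight L (sqrt_gt1 t1).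
have [C2 C20 HC2] := natrX_le_exp (size L) (sqrt_gt1 t1).
exists (C1 * C2); first by rewrite mulr_ge0.
move=> n kappa f; elim=> [|l ka k f' g' h1 h2 h3 IH]; first by rewrite wnorm0 mulr0.
apply: le_trans (wnormD _ _) _; rewrite mulrDr lerD//.
have t0 : 0 <= t by rewrite (le_trans ler01)// ltW.
have c0 : 0 <= C1 * C2 * t ^+ n by rewrite !mulr_ge0// exprn_ge0.
apply: le_trans (ler_wpM2l c0 h2).
pose S := \sum_(m <- fsupp f') normc (f' m).
have S2 : S <= Num.sqrt ((size (fsupp f'))%:R * l2norm2 f').
  rewrite -[leLHS]ger0_norm; last by apply: sumr_ge0 => m _; rewrite normc_ge0.
  rewrite -sqrtr_sqr ler_wsqrtr//.
  have := @weighted_cauchy_schwarz R tfpt (fsupp f') (fun=> 1) (fun m => normc (f' m)) (fun=> ler01).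
  under eq_bigr do rewrite mul1r.
  under [X in _ <= _ * X -> _]eq_bigr do rewrite mul1r.
  by rewrite big_const_seq count_predT iter_addr addr0.
have sz : (size (fsupp f') <= n.+1 ^ size L)%N.
  rewrite -size_box -(size_map (fun m => m - l)); apply: uniq_leq_size.
    by rewrite uniq_shift ?fsupp_uniq.
  by move=> _ /mapP[m mf ->]; apply: h1; rewrite -mem_fsupp.
have sq1 : Num.sqrt ((size (fsupp f'))%:R * l2norm2 f') <= C2 * Num.sqrt t ^+ n * Num.sqrt (l2norm2 f').
  rewrite sqrtrM ?ler0n// ler_wpM2r ?sqrtr_ge0//.
  (* The square root of the number of points is bounded crudely by the number itself; both are
     subexponential. *)
  apply: le_trans (HC2 n); rewrite (@le_trans _ _ (size (fsupp f'))%:R) ?ler_nat//.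
  rewrite -[leRHS]ger0_norm ?ler0n// -sqrtr_sqr ler_wsqrtr// expr2.
  by rewrite -natrM ler_nat; case: (size (fsupp f')) => [//|j]; exact: leq_pmulr.
apply: (@le_trans _ _ (v l * (C1 * Num.sqrt t ^+ n) * S)).
  rewrite /wnorm mulr_sumr big_seq [leRHS]big_seq; apply: ler_sum => m mf.
  rewrite ler_wpM2r ?normc_ge0//.
  have := v_sub l (m - l); rewrite [l + _]addrC subrK => h; apply: le_trans h _.
  by rewrite ler_wpM2l//; apply: HC1; apply: h1; rewrite -mem_fsupp.
have -> : C1 * C2 * t ^+ n * (v l * Num.sqrt (l2norm2 f')) =
   v l * (C1 * Num.sqrt t ^+ n) * (C2 * Num.sqrt t ^+ n * Num.sqrt (l2norm2 f')).
  by rewrite -(@sqrtX2 t n)//; ring.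
rewrite ler_wpM2l ?(le_trans S2)//.
by rewrite !mulr_ge0// exprn_ge0// sqrtr_ge0.
Qed.

(** The order of quantifiers is the point: [C] is fixed by [b] and the rates before [a] is given, so
    one constant serves all elements near [b]. *)
Lemma power_bound (b : falg) (q eta theta : R) :
  0 <= q -> 0 <= eta -> q + eta < theta ->
  (forall f, l2norm2 (b * f) <= q ^+ 2 * l2norm2 f) ->
  exists2 C, 0 <= C & forall a n, `N (a - b) <= eta -> `N (a ^+ n) <= C * theta ^+ n.
Proof.
move=> q0 eta0 qt bq; set s := q + eta in qt.
have s0 : 0 <= s by rewrite addr_ge0.
have t0 : 0 < theta by exact: le_lt_trans qt.
(* The pieces of a^n will have total at most s'^n. The gap to [theta] gives theta / s' > 1, the rate
   available for the subexponential loss; [s'] also stays positive when s = 0. *)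
pose s' := (s + theta) / 2.
have ss' : s < s' by rewrite /s'; lra.
have s'0 : 0 < s' by exact: le_lt_trans ss'.
have ts : 1 < theta / s' by rewrite ltr_pdivlMr// mul1r /s'; lra.
have [C C0 HC] := piece_wnorm (fsupp b) ts.
exists C => // a n ab.
have pa : piece (fsupp b) n (s' ^+ n) (a ^+ n).
  elim: n => [|n IH]; first by rewrite !expr0; exact: piece1.
  (* In a^(n+1) = (a - b) a^n + b a^n the first summand costs at most a factor [eta], the second a
     factor [q]. *)
  rewrite !exprS -[X in X * a ^+ n](subrK b) mulrDl.
  apply: (@piece_le _ _ (`N (a - b) * s' ^+ n + q * s' ^+ n)).
    rewrite -mulrDl ler_wpM2r ?exprn_ge0 ?(ltW s'0)//.
    by move: ab (ltW ss'); rewrite /s; lra.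
  apply: pieceD; first exact: piece_mul_any.
  by apply: piece_mul_fixed => // l; rewrite mem_fsupp.
apply: le_trans (HC _ _ _ pa) _.
by rewrite expr_div_n mulrA divfK ?gt_eqF ?exprn_gt0.
Qed.
End weight.
End norms.

(** * The involution and the l^2 contraction *)

Section adjoint.
Variables (R : realType) (d : nat).
Local Notation tfpt := (tfpt R d).
Local Notation normc := (@Normc.normc R).
Local Notation falg := (falg R d).
Implicit Types (c f g : falg) (k l m : tfpt).

Fact star_finite f : finite_set [set l | conjc (f (- l)) * cocycle l l != 0].
Proof.
apply: (@finite_support_seq _ _ _ [seq - l | l <- fsupp f]) => l ln.
have [->|fl] := eqVneq (f (- l)) 0; first by rewrite conjc0 mul0r.
case/negP: ln; apply/mapP; exists (- l); last by rewrite opprK.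
by rewrite mem_fsupp.
Qed.
(** The phase comes from U_l^(-1) = sigma(l, l) U_(-l). *)
Definition star f := Falg (star_finite f).

Lemma starE f l : fcoef (star f) l = conjc (f (- l)) * cocycle l l.
Proof. by []. Qed.

Lemma starB f g : star (f - g) = star f - star g.
Proof.
apply: falgP => l; rewrite starE.
rewrite [RHS]fcoefD fcoefN !starE fcoefD fcoefN.
by rewrite rmorphB mulrBl.
Qed.

Lemma normc_conj (z : R[i]) : normc (conjc z) = normc z.
Proof. by case: z => x y /=; rewrite sqrrN. Qed.

Lemma star_supp f l : star f l != 0 -> l \in [seq - l | l <- fsupp f].
Proof.
rewrite starE => h; apply/mapP; exists (- l); last by rewrite opprK.
by rewrite mem_fsupp; apply: contra h => /eqP ->; rewrite conjc0 mul0r.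
Qed.

Lemma uniq_opp f : uniq [seq - l | l <- fsupp f].
Proof. by rewrite map_inj_uniq ?fsupp_uniq//; exact: oppr_inj. Qed.

Lemma wnorm_star (v : tfpt -> R) f : (forall l, v (- l) = v l) ->
  wnorm v (star f) = wnorm v f.
Proof.
move=> vN; rewrite (wnorm_J _ (uniq_opp f) (@star_supp f)) big_map.
apply: eq_bigr => l _.
by rewrite vN starE Normc.normcM normc_cocycle mulr1 normc_conj opprK.
Qed.

Definition inner f g : R[i] := \sum_(l <- fsupp f) f l * conjc (g l).

Lemma conjcM (z w : R[i]) : conjc (z * w) = conjc z * conjc w.
Proof. exact: rmorphM. Qed.

Lemma cocycle_adjoint k l :
  conjc (cocycle (- k) (- k) * cocycle (- k) (k + l)) = cocycle k l.
Proof.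
rewrite /cocycle -expiD conj_expi; congr expi.
by rewrite /= dotvDl !dotvNr !dotvNl; ring.
Qed.

Lemma inner_adjoint c f g : inner (c * f) g = inner f (star c * g).
Proof.
rewrite /inner (sum_fmul c f (fun m => conjc (g m))) exchange_big/=.
apply: eq_bigr => l _; rewrite [X in conjc X]fcoefM rmorph_sum/= mulr_sumr.
rewrite (@sum_fsupp _ _ _ (star c) _ _ (uniq_opp c) _ (@star_supp c)); last first.
  move=> m h; have {}h : conjc (c (- m)) * cocycle m m = 0 := h.
  by rewrite h !mul0r conjc0 mulr0.
rewrite big_map; apply: eq_bigr => k _.
rewrite !opprK [l + k]addrC !conjcM conjcK.
rewrite -(cocycle_adjoint k l) conjcM; ring.
Qed.

Lemma mulconjc (z : R[i]) : z * conjc z = (normc z ^+ 2)%:C%C.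
Proof. by rewrite sqr_normc; case: z => x y; apply/eqP; rewrite eq_complex/=; apply/andP; split; apply/eqP; ring. Qed.

Lemma inner_self f : inner f f = (l2norm2 f)%:C%C.
Proof. by rewrite /inner /l2norm2 rmorph_sum; apply: eq_bigr => l _; rewrite mulconjc. Qed.

Lemma mono0M (s : R[i]) f m : fcoef (mono s 0 * f) m = s * f m.
Proof. by rewrite monoM cocycle0l subr0 mulr1. Qed.

Lemma sqr_normcB (s : R) (z w : R[i]) : normc (z - s%:C%C * w) ^+ 2 =
  normc z ^+ 2 - 2 * s * complex.Re (z * conjc w) + s ^+ 2 * normc w ^+ 2.
Proof. by rewrite !sqr_normc; case: z => x y; case: w => x' y' /=; ring. Qed.

Lemma l2norm2_sub_scale (s : R) f g :
  l2norm2 (f - mono s%:C%C 0 * g) =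
  l2norm2 f - 2 * s * complex.Re (inner f g) + s ^+ 2 * l2norm2 g.
Proof.
pose J := undup (fsupp f ++ fsupp g).
have uJ : uniq J by exact: undup_uniq.
have fJ l : f l != 0 -> l \in J by move=> fl; rewrite mem_undup mem_cat !mem_fsupp fl.
have gJ l : g l != 0 -> l \in J by move=> gl; rewrite mem_undup mem_cat !mem_fsupp gl orbT.
have hE l : fcoef (f - mono s%:C%C 0 * g) l = f l - s%:C%C * g l.
  by rewrite fcoefD fcoefN mono0M.
have hJ l : fcoef (f - mono s%:C%C 0 * g) l != 0 -> l \in J.
  rewrite hE mem_undup mem_cat !mem_fsupp -negb_and.
  by apply: contra => /andP[/eqP -> /eqP ->]; rewrite mulr0 subr0.
rewrite (l2norm2_J uJ hJ) (l2norm2_J uJ fJ) (l2norm2_J uJ gJ).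
have -> : inner f g = \sum_(l <- J) f l * conjc (g l).
  by apply: sum_fsupp => // l ->; rewrite mul0r.
rewrite raddf_sum !mulr_sumr -sumrB -big_split; apply: eq_bigr => l _.
by rewrite hE; exact: sqr_normcB.
Qed.

(** The square expands to ||f||^2 - (2/M) ||c f||^2 + M^(-2) ||c^* c f||^2. Young's inequality
    bounds the last term by ||c f||^2 / M, so a net gain of ||c f||^2 / M remains. *)
Lemma contraction (v : tfpt -> R) c (delta M : R) :
  (forall l, 1 <= v l) -> (forall l, v (- l) = v l) ->
  0 < M -> wnorm v c ^+ 2 <= M ->
  (forall f, delta * l2norm2 f <= l2norm2 (c * f)) ->
  forall f, l2norm2 ((1 - mono (M^-1)%:C%C 0 * star c * c) * f) <=
    (1 - delta / M) * l2norm2 f.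
Proof.
move=> v1 vN M0 cM lb f.
rewrite mulrBl mul1r -!mulrA l2norm2_sub_scale -inner_adjoint inner_self/=.
have kle : l2norm2 (star c * (c * f)) <= M * l2norm2 (c * f).
  apply: le_trans (l2norm2M_le _ _ v1) _; rewrite wnorm_star//.
  by rewrite ler_wpM2r// l2norm2_ge0.
have Mi : 0 < M^-1 by rewrite invr_gt0.
apply: (@le_trans _ _ (l2norm2 f - 2 / M * l2norm2 (c * f) + (M^-1) ^+ 2 * (M * l2norm2 (c * f)))).
  by rewrite lerD2l ler_wpM2l// sqr_ge0.
have -> : (M^-1) ^+ 2 * (M * l2norm2 (c * f)) = M^-1 * l2norm2 (c * f).
  by field; rewrite gt_eqF.
have := ler_wpM2l (ltW Mi) (lb f).
rewrite [delta / M]mulrC; lra.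
Qed.
End adjoint.

(** * Approximate left inverses *)

Section approximate_inverse.
Variables (R : realType) (d : nat).
Local Notation tfpt := (tfpt R d).
Local Notation falg := (falg R d).
Variable v : tfpt -> R.
Hypothesis v_1 : v 0 = 1.
Hypothesis v_ge1 : forall l, 1 <= v l.
Hypothesis v_sub : forall l m, v (l + m) <= v l * v m.
Hypothesis v_opp : forall l, v (- l) = v l.
Hypothesis v_GRS : forall l (t : R), 1 < t ->
  exists C, forall n, v (l *+ n) <= C * t ^+ n.
Local Notation "'`N' f" := (wnorm v f) (at level 10, f at level 9).

Definition wcauchy (c : nat -> falg) := forall e : R, 0 < e ->
  exists n0, forall m n, (n0 <= m)%N -> (n0 <= n)%N -> `N (c m - c n) <= e.

Lemma wnorm_mono0 (s : R) : 0 <= s -> `N (mono s%:C%C 0) = s.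
Proof.
move=> s0; rewrite (@wnorm_J _ _ v _ [:: 0])//; last first.
  by move=> l; rewrite monoE inE; case: (l =P 0) => //; rewrite eqxx.
by rewrite big_seq1 v_1 mul1r monoE eqxx /= expr0n/= addr0 sqrtr_sqr ger0_norm.
Qed.

Lemma geometric_small (t e : R) : 0 <= t < 1 -> 0 < e ->
  exists n0, forall n, (n0 <= n)%N -> t ^+ n <= e.
Proof.
move=> /andP[t0 t1] e0.
have /cvgrPdist_le /(_ e e0) [n0 _ H] : t ^+ n @[n --> \oo] --> 0.
  by apply: cvg_expr; rewrite ger0_norm.
exists n0 => n /H; rewrite /= sub0r normrN ger0_norm// exprn_ge0//.
Qed.

Lemma geometric_sum_le (t : R) n : 0 <= t < 1 -> \sum_(k < n) t ^+ k <= (1 - t)^-1.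
Proof.
move=> /andP[t0 t1]; have t1' : 0 < 1 - t by rewrite subr_gt0.
have h : (1 - t) * \sum_(k < n) t ^+ k = 1 - t ^+ n.
  by rewrite -[1 - t]opprB mulNr -subrX1 opprB.
rewrite -(ler_pM2l t1') h divff ?gt_eqF// gerBl exprn_ge0//.
Qed.

Lemma wnorm_sum n (F : 'I_n -> falg) : `N (\sum_(k < n) F k) <= \sum_(k < n) `N (F k).
Proof.
elim/big_rec2: _ => [|i x y _ IH]; first by rewrite wnorm0.
by apply: le_trans (wnormD v_ge1 _ _) _; rewrite lerD2l.
Qed.

(** With a_n = 1 - c_n^* c_n / M, the witness is e_n = (1 + a_n + ... + a_n^(n-1)) c_n^* / M. Then 1
    - e_n c_n = a_n^n exactly, and one index governs both truncation and approximation. *)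
Lemma approximate_inverse (c : nat -> falg) (delta B : R) :
  0 < delta -> (forall n, `N (c n) <= B) -> wcauchy c ->
  (forall n f, delta * l2norm2 f <= l2norm2 (c n * f)) ->
  exists2 e, wcauchy e & forall eps : R, 0 < eps ->
    exists n0, forall n, (n0 <= n)%N -> `N (1 - e n * c n) <= eps.
Proof.
move=> delta0 cB0 cC lb.
(* The added 1 makes the bound strictly positive, so that [M] can be inverted. *)
pose B1 := B + 1.
have B1p : 0 < B1 by rewrite /B1; have := le_trans (wnorm_ge0 v_ge1 _) (cB0 0%N); lra.
have cB n : `N (c n) <= B1 by rewrite /B1; have := cB0 n; lra.
pose M := B1 ^+ 2; have M0 : 0 < M by rewrite exprn_gt0.
pose s n := mono (M^-1)%:C%C 0 * star (c n).
pose h n := s n * c n; pose a n := 1 - h n.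
have sC m n : `N (s m - s n) <= M^-1 * `N (c m - c n).
  rewrite /s -mulrBr -starB; apply: le_trans (wnormM v_ge1 v_sub _ _) _.
    by rewrite wnorm_mono0 ?invr_ge0 ?(ltW M0)// wnorm_star.
have sB n : `N (s n) <= M^-1 * B1.
  apply: le_trans (wnormM v_ge1 v_sub _ _) _.
  by rewrite wnorm_mono0 ?invr_ge0 ?(ltW M0)// wnorm_star// ler_wpM2l// invr_ge0 ltW.
pose D := 2 * (M^-1 * B1); have D0 : 0 < D by rewrite !mulr_gt0// invr_gt0.
have hC m n : `N (h m - h n) <= D * `N (c m - c n).
  have -> : h m - h n = s m * (c m - c n) + (s m - s n) * c n.
    by rewrite /h mulrBr mulrBl addrA subrK.
  apply: le_trans (wnormD v_ge1 _ _) _.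
  have h1 : `N (s m * (c m - c n)) <= (M^-1 * B1) * `N (c m - c n).
    by apply: le_trans (wnormM v_ge1 v_sub _ _) _; rewrite ler_wpM2r ?wnorm_ge0.
  have h2 : `N ((s m - s n) * c n) <= (M^-1 * `N (c m - c n)) * B1.
    by apply: le_trans (wnormM v_ge1 v_sub _ _) _; rewrite ler_pM ?wnorm_ge0.
  by apply: le_trans (lerD h1 h2) _; rewrite /D; lra.
(* [Num.sqrt] is 0 on negative numbers, so [q2] is stated as an inequality that covers this case. *)
pose q := Num.sqrt (1 - delta / M).
have q0 : 0 <= q by rewrite sqrtr_ge0.
have dM0 : 0 < delta / M by rewrite divr_gt0.
have q1 : q < 1 by rewrite -[ltRHS]sqrtr1 ltr_sqrt// gtrBl.
have q2 : 1 - delta / M <= q ^+ 2.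
  have [le0|gt0] := leP (1 - delta / M) 0; first by rewrite (le_trans le0)// sqr_ge0.
  by rewrite sqr_sqrtr// ltW.
have acontr n f : l2norm2 (a n * f) <= q ^+ 2 * l2norm2 f.
  apply: le_trans (ler_wpM2r (l2norm2_ge0 _) q2).
  apply: (contraction v_ge1 v_opp M0 _ (lb n)).
  by rewrite lerXn2r ?nnegrE ?wnorm_ge0// ltW.
(* Any choice with eta > 0 and q + eta < theta < 1 would serve. *)
pose eta := (1 - q) / 4; pose theta := (1 + q) / 2.
have eta0 : 0 < eta by rewrite /eta; lra.
have theta01 : 0 <= theta < 1 by rewrite /theta; apply/andP; split; lra.
have qet : q + eta < theta by rewrite /theta /eta; lra.
have aB m n : a m - a n = h n - h m by rewrite /a opprB addrC addrA subrK addrC.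
(* [a n1] is the fixed element that determines the constant of [power_bound]; all later [a n] stay
   within [eta] of it. *)
have [n1 Hn1] := cC (eta / D) (divr_gt0 eta0 D0).
have aeta n : (n1 <= n)%N -> `N (a n - a n1) <= eta.
  move=> n1n; rewrite aB; apply: le_trans (hC _ _) _.
  by rewrite mulrC -ler_pdivlMr// Hn1.
have [C C0 HC] := power_bound v_1 v_ge1 v_sub v_GRS q0 (ltW eta0) qet (acontr n1).
have powB n k : (n1 <= n)%N -> `N (a n ^+ k) <= C * theta ^+ k.
  by move=> n1n; apply: HC; exact: aeta.
pose y n := \sum_(k < n) a n ^+ k.
pose Y := C * (1 - theta)^-1 + 1.
have th1 : 0 < 1 - theta by case/andP: theta01 => _; rewrite subr_gt0.
have Y0 : 0 < Y by rewrite ltr_wpDl// mulr_ge0// invr_ge0 ltW.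
have yB n : (n1 <= n)%N -> `N (y n) <= Y.
  move=> n1n; apply: le_trans (wnorm_sum _) _.
  apply: (@le_trans _ _ (\sum_(k < n) C * theta ^+ k)).
    by apply: ler_sum => k _; exact: powB.
  rewrite -mulr_sumr (@le_trans _ _ (C * (1 - theta)^-1))//; last by rewrite lerDl.
  by rewrite ler_wpM2l// geometric_sum_le.
have hy n : h n * y n = 1 - a n ^+ n.
  have := subrX1 (a n) n; rewrite -/(y n) /a.
  have -> : 1 - h n - 1 = - h n by rewrite addrAC subrr add0r.
  by rewrite mulNr => /eqP; rewrite -eqr_oppLR opprB => /eqP.
have yh n : y n * h n = 1 - a n ^+ n.
  rewrite -hy; apply/esym; rewrite /y; apply: commr_sum => k _; apply: commrX.
  by rewrite /a; apply: commrB; [exact: commr1|].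
have small (x eps : R) : 0 < x -> 0 < eps -> exists n0, forall n, (n0 <= n)%N -> x * (C * theta ^+ n) <= eps.
  move=> x0 e0; have xC : 0 < x * (C + 1) by rewrite mulr_gt0// ltr_wpDl.
  have [n0 Hn0] := geometric_small theta01 (divr_gt0 e0 xC).
  exists n0 => n /Hn0; rewrite ler_pdivlMr// => H; apply: le_trans H.
  rewrite mulrA [leRHS]mulrC ler_wpM2r ?exprn_ge0//; first by case/andP: theta01.
  by rewrite ler_wpM2l ?(ltW x0)// lerDl.
exists (fun n => y n * s n); last first.
  move=> eps e0; have [n0 Hn0] := small 1 eps ltr01 e0.
  exists (maxn n0 n1) => n; rewrite geq_max => /andP[n0n n1n].
  rewrite -mulrA -/(h n) yh opprB addrC subrK.
  by apply: le_trans (powB _ _ n1n) _; rewrite -[leLHS]mul1r Hn0.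
have yC : wcauchy y.
  move=> eps e0; have e3 : 0 < eps / 3 by rewrite divr_gt0.
  have [n2 Hn2] := small Y (eps / 3) Y0 e3.
  have YYD : 0 < Y * Y * D by apply: mulr_gt0 => //; exact: mulr_gt0.
  have [n3 Hn3] := cC (eps / 3 / (Y * Y * D)) (divr_gt0 e3 YYD).
  exists (maxn n1 (maxn n2 n3)) => m n.
  rewrite !geq_max => /and3P[m1 m2 m3] /and3P[k1 k2 k3].
  (* A resolvent identity for approximate inverses: [y n] inverts [h n] from the right up to
     [a n ^+ n], and [y m] inverts [h m] from the left up to [a m ^+ m]. It avoids comparing powers
     of [a m] and [a n] term by term. *)
  have -> : y m - y n = y m * a n ^+ n + y m * (h n - h m) * y n - a m ^+ m * y n.
    have -> : a n ^+ n = 1 - h n * y n by rewrite hy opprB addrC subrK.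
    have -> : a m ^+ m = 1 - y m * h m by rewrite yh opprB addrC subrK.
    rewrite mulrBr mulrBr !mulrBl mulr1 mul1r !mulrA.
    by rewrite [y m - _ + _]addrA subrK opprB addrA subrK.
  apply: le_trans (wnormD v_ge1 _ _) _; rewrite wnormN//.
  apply: (@le_trans _ _ (eps / 3 + eps / 3 + eps / 3)); last by lra.
  apply: lerD; last first.
    apply: le_trans (wnormM v_ge1 v_sub _ _) _; rewrite mulrC; apply: le_trans (Hn2 _ m2).
    by rewrite ler_pM ?wnorm_ge0 ?yB ?powB.
  apply: le_trans (wnormD v_ge1 _ _) _; apply: lerD.
    apply: le_trans (wnormM v_ge1 v_sub _ _) _; apply: le_trans (Hn2 _ k2).
    by rewrite ler_pM ?wnorm_ge0 ?yB ?powB.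
  apply: le_trans (wnormM v_ge1 v_sub _ _) _.
  apply: (@le_trans _ _ ((Y * (D * `N (c n - c m))) * Y)).
    rewrite ler_pM ?wnorm_ge0 ?yB//.
    apply: le_trans (wnormM v_ge1 v_sub _ _) _.
    by rewrite ler_pM ?wnorm_ge0 ?yB.
  have -> : Y * (D * `N (c n - c m)) * Y = `N (c n - c m) * (Y * Y * D) by ring.
  by rewrite -ler_pdivlMr// Hn3.
move=> eps e0; have e2 : 0 < eps / 2 by rewrite divr_gt0.
have MB : 0 < M^-1 * B1 by rewrite mulr_gt0// invr_gt0.
have YM : 0 < Y / M by rewrite divr_gt0.
have [n2 Hn2] := yC _ (divr_gt0 e2 MB).
have [n3 Hn3] := cC _ (divr_gt0 e2 YM).
exists (maxn n1 (maxn n2 n3)) => m n.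
rewrite !geq_max => /and3P[m1 m2 m3] /and3P[k1 k2 k3].
have -> : y m * s m - y n * s n = (y m - y n) * s m + y n * (s m - s n).
  by rewrite mulrBl mulrBr addrA subrK.
apply: le_trans (wnormD v_ge1 _ _) _.
apply: (@le_trans _ _ (eps / 2 + eps / 2)); last by lra.
apply: lerD; apply: le_trans (wnormM v_ge1 v_sub _ _) _.
  apply: (@le_trans _ _ (`N (y m - y n) * (M^-1 * B1))).
    by rewrite ler_wpM2l ?wnorm_ge0.
  by rewrite -ler_pdivlMr// Hn2.
apply: (@le_trans _ _ (Y * (M^-1 * `N (c m - c n)))).
  by rewrite ler_pM ?wnorm_ge0 ?yB.
by rewrite mulrA mulrC -ler_pdivlMr// Hn3.
Qed.
End approximate_inverse.

(** * Transference from L^2(R^d) to l^2(R^{2d}) *)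

Section transference.
Variables (R : realType) (d : nat).
Local Notation tfpt := (tfpt R d).
Local Notation normc := (@Normc.normc R).
Local Notation falg := (falg R d).
Local Notation fn := (fn R d).
Implicit Types (c g : falg) (f h phi : fn) (k l m z : tfpt).

(** The symplectic character by which U_l and U_z fail to commute. Conjugation by U_z therefore only
    modulates a symbol and leaves every |g(l)| unchanged. *)
Definition chi z l : R[i] := expi (dotv l.2 z.1 - dotv z.2 l.1).

Lemma U_commute l z phi x : U l (U z phi) x = chi z l * U z (U l phi) x.
Proof.
rewrite !U_U mulrA [z + l]addrC; congr (_ * _).
by rewrite /chi /cocycle -expiD; congr expi; ring.
Qed.

Lemma chiD z z' l : chi (z + z') l = chi z l * chi z' l.
Proof. by rewrite /chi -expiD; congr expi; rewrite dotvDl dotvDr; ring. Qed.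

Lemma chi_conj z l m : chi z l * conjc (chi z m) = chi z (l - m).
Proof.
rewrite /chi conj_expi -expiD; congr expi.
by rewrite dotvDl dotvDr dotvNl dotvNr; ring.
Qed.

Lemma dotv_ge0 (x : vec R d) : 0 <= dotv x x.
Proof. by apply: sumr_ge0 => i _; rewrite -expr2 sqr_ge0. Qed.

Lemma dotv_eq0 (x : vec R d) : dotv x x = 0 -> x = 0.
Proof.
move=> h; apply/rowP => i; rewrite mxE.
have : \sum_(j < d) x ord0 j * x ord0 j == 0 by apply/eqP.
rewrite psumr_eq0 => [/allP /(_ i (mem_index_enum i)) /=|j _]; last first.
  by rewrite -expr2 sqr_ge0.
by rewrite mulf_eq0 orbb => /eqP.
Qed.

Lemma dotvZr (a : R) (x y : vec R d) : dotv x (a *: y) = a * dotv x y.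
Proof. by rewrite mulr_sumr; apply: eq_bigr => i _; rewrite mxE; ring. Qed.

Lemma dotvZl (a : R) (x y : vec R d) : dotv (a *: x) y = a * dotv x y.
Proof. by rewrite mulr_sumr; apply: eq_bigr => i _; rewrite mxE; ring. Qed.

Lemma exists_chi_N1 l : l != 0 -> exists z, chi z l = -1.
Proof.
move=> l0; pose n := dotv l.1 l.1 + dotv l.2 l.2.
have n0 : n != 0.
  apply: contra l0 => /eqP.
  move/eqP; rewrite paddr_eq0 ?dotv_ge0// => /andP[/eqP/dotv_eq0 h1 /eqP/dotv_eq0 h2].
  by rewrite [l]surjective_pairing h1 h2.
(* The symplectic rotation of [l], scaled by pi / |l|^2, makes the phase exactly pi. *)
exists ((pi / n) *: l.2, - ((pi / n) *: l.1)).
rewrite /chi/= dotvZr dotvNl dotvZl opprK -mulrDr addrC -/n divfK//.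
by rewrite /expi cospi sinpi; apply/eqP; rewrite eq_complex/= eqxx oppr0 eqxx.
Qed.

(* Riesz-product trick: doubling [Z] into [Z ++ (z0 + Z)] with chi z0 l = -1 kills
   the frequency [l] exactly and keeps those already killed. *)
Lemma exists_annihilating_shifts (D : seq tfpt) : 0 \notin D ->
  exists2 Z : seq tfpt, (0 < size Z)%N & forall l, l \in D -> \sum_(z <- Z) chi z l = 0.
Proof.
elim: D => [|l D IH]; first by exists [:: 0].
rewrite inE negb_or eq_sym => /andP[l0 /IH[Z Z0 HZ]].
have [z0 hz0] := exists_chi_N1 l0.
exists (Z ++ [seq z0 + z | z <- Z]) => [|m mD].
  by rewrite size_cat addn_gt0 Z0.
have -> : \sum_(z <- Z ++ [seq z0 + z | z <- Z]) chi z m =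
    (1 + chi z0 m) * \sum_(z <- Z) chi z m.
  rewrite big_cat big_map mulrDl mul1r mulr_sumr; congr (_ + _).
  by apply: eq_bigr => z _; rewrite chiD.
move: mD; rewrite inE => /orP[/eqP ->|/HZ ->]; last by rewrite mulr0.
by rewrite hz0 addrN mul0r.
Qed.

Fact modulate_finite z g : finite_set [set l | chi z l * g l != 0].
Proof.
apply: (@finite_support_seq _ _ _ (fsupp g)) => l.
by rewrite mem_fsupp negbK => /eqP ->; rewrite mulr0.
Qed.
Definition modulate z g := Falg (modulate_finite z g).

Lemma Tf_modulate z g phi : Tf (modulate z g) phi =
  fun x => \sum_(l <- fsupp g) chi z l * g l * U l phi x.
Proof.
apply/funext => x; rewrite (@Tf_J _ _ _ (fsupp g)) ?fsupp_uniq// => l.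
by rewrite mem_fsupp /= mulf_eq0 negb_or => /andP[].
Qed.

Lemma Tf_U z g phi : Tf g (U z phi) = U z (Tf (modulate z g) phi).
Proof.
apply/funext => x; rewrite Tf_modulate /Tf /U mulr_sumr.
apply: eq_bigr => l _.
have := U_commute l z phi x; rewrite /U => ->.
by ring.
Qed.

(** Orthogonality of characters in finite form: once the square is expanded, the sum over [Z]
    cancels the cross terms at every point x, before any integration. *)
Lemma modulate_average g Z phi x :
  (forall l m, l \in fsupp g -> m \in fsupp g -> l != m -> \sum_(z <- Z) chi z (l - m) = 0) ->
  \sum_(z <- Z) normc (Tf (modulate z g) phi x) ^+ 2 =
  (size Z)%:R * \sum_(l <- fsupp g) normc (g l) ^+ 2 * normc (U l phi x) ^+ 2.
Proof.
move=> HZ; apply: complexI.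
pose A l := g l * U l phi x.
transitivity (\sum_(l <- fsupp g) \sum_(m <- fsupp g)
    (\sum_(z <- Z) chi z (l - m)) * (A l * conjc (A m))).
  rewrite rmorph_sum/=.
  transitivity (\sum_(z <- Z) \sum_(l <- fsupp g) \sum_(m <- fsupp g)
    chi z (l - m) * (A l * conjc (A m))).
    apply: eq_bigr => z _; rewrite -mulconjc Tf_modulate.
    have -> : conjc (\sum_(l <- fsupp g) chi z l * g l * U l phi x) =
       \sum_(l <- fsupp g) conjc (chi z l * g l * U l phi x) by rewrite rmorph_sum.
    rewrite mulr_suml; apply: eq_bigr => l _; rewrite mulr_sumr; apply: eq_bigr => m _.
    by rewrite -chi_conj /A !conjcM; ring.
  rewrite exchange_big; apply: eq_bigr => l _.
  by rewrite exchange_big; apply: eq_bigr => m _; rewrite mulr_suml.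
rewrite rmorphM/= rmorph_sum/= mulr_sumr big_seq [RHS]big_seq.
apply: eq_bigr => l lg.
rewrite (bigD1_seq l) ?fsupp_uniq//.
transitivity ((\sum_(z <- Z) chi z (l - l)) * (A l * conjc (A l)) + 0).
  congr (_ + _); rewrite big_seq_cond big1// => m /andP[mg ml].
  by rewrite (HZ l m lg mg) ?mul0r// eq_sym.
rewrite addr0.
have -> : \sum_(z <- Z) chi z (l - l) = (size Z)%:R.
  rewrite subrr (eq_bigr (fun=> 1)) => [|z _].
    by rewrite big_const_seq count_predT iter_addr addr0.
  by rewrite /chi dotv0l dotv0r subrr expi0.
by rewrite mulconjc -exprMn -Normc.normcM rmorph_nat.
Qed.

Lemma iint_sum (I : Type) (J : seq I) (a : I -> R) (F : I -> fn) :
  (forall i, 0 <= a i) -> (forall i, cmeas (F i)) ->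
  (iint (fun x : brV R d => (\sum_(i <- J) a i * normc (F i x) ^+ 2)%:E) =
   \sum_(i <- J) (a i)%:E * l2sq (F i))%E.
Proof.
move=> a0 mF.
have mone i : measurable_fun setT ((fun x => (a i * normc (F i x) ^+ 2)%:E) : brV R d -> \bar R).
  apply/measurable_EFinP; apply: measurable_funM; first exact: measurable_cst.
  exact: cmeas_normc2.
elim: J => [|i J IH].
  rewrite big_nil -[RHS](@iint_zero R d).
  by apply: iint_eq => x; rewrite big_nil.
rewrite big_cons -IH /l2sq -(@iintZl R d)//; last 2 first.
- exact: cmeas_l2.
- by move=> x; rewrite lee_fin sqr_ge0.
rewrite -(@iintD R d)//.
- by apply: iint_eq => x; rewrite big_cons EFinD EFinM.
- exact: mone.
- apply/measurable_EFinP; apply: measurable_sum => j.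
  by apply/measurable_EFinP; exact: mone.
- by move=> x; rewrite -EFinM lee_fin mulr_ge0// sqr_ge0.
- by move=> x; rewrite lee_fin sumr_ge0// => j _; rewrite mulr_ge0// sqr_ge0.
Qed.

Lemma l2sq_average g Z phi : cmeas phi ->
  (forall l m, l \in fsupp g -> m \in fsupp g -> l != m -> \sum_(z <- Z) chi z (l - m) = 0) ->
  (\sum_(z <- Z) l2sq (Tf g (U z phi)) = ((size Z)%:R * l2norm2 g)%:E * l2sq phi)%E.
Proof.
move=> mphi HZ.
transitivity (\sum_(z <- Z) 1%:E * l2sq (Tf (modulate z g) phi))%E.
  by apply: eq_bigr => z _; rewrite Tf_U l2sq_U ?mul1e//; exact: cmeas_Tf.
rewrite -iint_sum//; last by move=> z; exact: cmeas_Tf.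
transitivity (iint (fun x : brV R d =>
   (\sum_(l <- fsupp g) ((size Z)%:R * normc (g l) ^+ 2) * normc (U l phi x) ^+ 2)%:E)).
  apply: iint_eq => x; congr (_%:E).
  under eq_bigr do rewrite mul1r.
  rewrite modulate_average// mulr_sumr; apply: eq_bigr => l _.
  by rewrite mulrA.
rewrite iint_sum; last 2 first.
- by move=> l; rewrite mulr_ge0// sqr_ge0.
- by move=> l; exact: cmeas_U.
under eq_bigr do rewrite l2sq_U//.
rewrite -ge0_sume_distrl; last by move=> l _; rewrite lee_fin mulr_ge0// sqr_ge0.
by rewrite sumEFin -mulr_sumr.
Qed.

Lemma opsum0 f x : opsum (fun=> 0) f x = 0.
Proof.
rewrite /opsum /csum; case: ifP => // _.
by rewrite !(@rsum_finite _ _ _ [::])// ?big_nil// => l _; rewrite mul0r.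
Qed.

Lemma Tf_bound (v : tfpt -> R) g (K : R) f : (forall l, 1 <= v l) -> 0 < K ->
  wnorm v g <= K -> cmeas f -> (l2sq (Tf g f) <= (2 * K ^+ 2)%:E * l2sq f)%E.
Proof.
move=> v1 K0 gK mf.
have e0 : ell1 (fun _ : tfpt => 0 : R[i]).
  rewrite /ell1 (@esum_seq _ _ _ [::])//.
  - by rewrite big_nil ltry.
  - by move=> l; rewrite Normc.normc0.
  - by move=> l _; rewrite Normc.normc0.
have gJ l : l \notin fsupp g -> g l = 0 by rewrite mem_fsupp negbK => /eqP.
have sK : (\esum_(l in [set: tfpt]) (normc (0 - g l))%:E <= K%:E)%E.
  rewrite (esum_seq (fsupp_uniq g)).
  - rewrite sumEFin lee_fin; apply: le_trans gK; apply: ler_sum => l _.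
    by rewrite sub0r normc_opp ler_peMl ?normc_ge0.
  - by move=> l; rewrite lee_fin normc_ge0.
  - by move=> l /gJ ->; rewrite subr0 Normc.normc0.
have := opsum_approx e0 (fsupp_uniq g) gJ K0 sK mf.
rewrite (_ : l2sq _ = l2sq (Tf g f))//.
by apply: iint_eq => x; rewrite opsum0 sub0r normc_opp.
Qed.

Lemma L2_Tf g f : L2 f -> L2 (Tf g f).
Proof.
move=> /L2P[mf ff]; apply/L2P; split; first exact: cmeas_Tf.
have one1 (l : tfpt) : 1 <= (1 : R) by [].
have K0 : 0 < wnorm (fun=> 1) g + 1 by rewrite ltr_wpDl// (wnorm_ge0 one1).
apply: le_lt_trans (Tf_bound one1 K0 _ mf) _; first by rewrite lerDl.
by rewrite lte_mul_pinfty// lee_fin mulr_ge0// sqr_ge0.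
Qed.

Lemma transference (c : falg) (D : R) phi : 0 < D -> L2 phi -> l2sq phi != 0%E ->
  (forall h, L2 h -> (l2sq h <= D%:E * l2sq (Tf c h))%E) ->
  forall f : falg, l2norm2 f <= D * l2norm2 (c * f).
Proof.
move=> D0 L2phi phi0 lb f.
have /L2P[mphi phifin] := L2phi.
(* The shifts must kill the nonzero differences of both supports, so that a single [Z] averages both
   sides and the common factor |Z| ||phi||^2 cancels. *)
pose diffs (J : seq tfpt) := [seq x <- [seq l - m | l <- J, m <- J] | x != 0].
have [|Z Z0 HZ] := @exists_annihilating_shifts (diffs (fsupp f) ++ diffs (fsupp (c * f))).
  by rewrite mem_cat !mem_filter eqxx.
have Hd (J : seq tfpt) l m : l \in J -> m \in J -> l != m -> l - m \in diffs J.
  by move=> lJ mJ lm; rewrite mem_filter subr_eq0 lm/=; apply/allpairsP; exists (l, m).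
have H1 := @l2sq_average f Z phi mphi _.
have H2 := @l2sq_average (c * f) Z phi mphi _.
have : (\sum_(z <- Z) l2sq (Tf f (U z phi)) <= D%:E * \sum_(z <- Z) l2sq (Tf (c * f)%R (U z phi)))%E.
  rewrite ge0_sume_distrr; last by move=> z _; exact: l2sq_ge0.
  by apply: lee_sum => z _; rewrite TfM; apply: lb; apply: L2_Tf; exact: L2_U.
rewrite H1; last by move=> l m lf mf lm; rewrite HZ// mem_cat Hd.
rewrite H2; last by move=> l m lf mf lm; rewrite HZ// mem_cat [X in _ || X]Hd ?orbT.
have pfin : l2sq phi \is a fin_num by rewrite ge0_fin_numE ?l2sq_ge0.
rewrite -(fineK pfin) -!EFinM lee_fin.
have p0 : 0 < fine (l2sq phi) by rewrite fine_gt0// phifin lt0e phi0 l2sq_ge0.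
rewrite mulrA ler_pM2r//.
have sZ : 0 < (size Z)%:R :> R by rewrite ltr0n.
by move=> h; rewrite -(ler_pM2l sZ) [leRHS]mulrCA.
Qed.
End transference.

(** * Density and completeness in weighted l^1 *)

Section weighted_l1.
Variables (R : realType) (d : nat).
Local Notation tfpt := (tfpt R d).
Local Notation normc := (@Normc.normc R).
Local Notation falg := (falg R d).
Variable v : tfpt -> R.
Hypothesis v_ge1 : forall l, 1 <= v l.
Implicit Types (c : tfpt -> R[i]) (g : falg).

Let v_ge0 l : 0 <= v l. Proof. exact: le_trans (v_ge1 l). Qed.

Definition wdist c g : \bar R := (\esum_(l in [set: tfpt]) (v l * normc (c l - g l))%:E)%E.

Let term_ge0 c l : (0 <= (v l * normc (c l))%:E)%E.
Proof. by rewrite lee_fin mulr_ge0 ?normc_ge0. Qed.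

Lemma wnormB_wdist c g g' (a b : R) : (wdist c g <= a%:E)%E -> (wdist c g' <= b%:E)%E ->
  wnorm v (g - g') <= a + b.
Proof.
move=> ga gb; apply: (@le_trans _ _ (\sum_(l <- fsupp (g - g'))
    (v l * normc (c l - g l) + v l * normc (c l - g' l)))).
  apply: ler_sum => l _; rewrite -mulrDr ler_wpM2l// fcoefD fcoefN.
  have -> : g l - g' l = (c l - g' l) + - (c l - g l) by ring.
  by apply: le_trans (normcD_le _ _) _; rewrite normc_opp addrC.
rewrite big_split lerD// -lee_fin -sumEFin.
- by apply: le_trans ga; apply: seq_le_esum; [exact: fsupp_uniq|move=> l; exact: (@term_ge0 (fun l => c l - g l))].
- by apply: le_trans gb; apply: seq_le_esum; [exact: fsupp_uniq|move=> l; exact: (@term_ge0 (fun l => c l - g' l))].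
Qed.

Lemma ell1w_ell1 c : ell1w v c -> ell1 c.
Proof.
by apply: le_lt_trans; apply: le_esum => l _; rewrite lee_fin ler_peMl ?normc_ge0.
Qed.

(** The witness is [c] restricted to a finite set whose partial sum comes within [e] of the supremum
    defining the unordered sum. *)
Lemma ell1w_approx c (e : R) : ell1w v c -> 0 < e -> exists g, (wdist c g <= e%:E)%E.
Proof.
move=> c1 e0; have T0 : (0 <= \esum_(l in [set: tfpt]) (v l * normc (c l))%:E)%E.
  by apply: esum_ge0 => l _; exact: term_ge0.
have Tfin : (\esum_(l in [set: tfpt]) (v l * normc (c l))%:E)%E \is a fin_num.
  by rewrite ge0_fin_numE.
have [_ [A [finA _] <-]] := ub_ereal_sup_adherent e0 Tfin.
rewrite -/(esum _ _) fsbig_finite//; set J := finmap.enum_fset _ => HJ.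
have uJ : uniq J by exact: finmap.fset_uniq.
have gfin : finite_set [set l | (if l \in J then c l else 0) != 0].
  by apply: (@finite_support_seq _ _ _ J) => l /negbTE ->.
exists (Falg gfin).
have split_sum : (\esum_(l in [set: tfpt]) (v l * normc (c l))%:E =
    wdist c (Falg gfin) + \sum_(l <- J) (v l * normc (c l))%:E)%E.
  have := @esum_seq R _ (fun l => (v l * normc (Falg gfin l))%:E) J uJ.
  rewrite [X in _ -> _ -> _ = X](_ : _ = \sum_(l <- J) (v l * normc (c l))%:E)%E; last first.
    by apply: eq_big_seq => l lJ; rewrite /= lJ.
  move=> <-; last 2 first.
  - by move=> l; exact: (@term_ge0 (Falg gfin)).
  - by move=> l /negbTE lJ; rewrite /= lJ Normc.normc0 mulr0.
  rewrite /wdist -esumD.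
  - apply: eq_esum => l _ /=; case: ifP => _.
      by rewrite subrr Normc.normc0 mulr0 add0e.
    by rewrite subr0 Normc.normc0 mulr0 adde0.
  - by move=> l _; exact: (@term_ge0 (fun l => c l - Falg gfin l)).
  - by move=> l _; exact: (@term_ge0 (Falg gfin)).
move: HJ; rewrite -/(esum _ _) split_sum -addeA => HJ.
have Jfin : (\sum_(l <- J) (v l * normc (c l))%:E)%E \is a fin_num by rewrite sumEFin.
have Dfin : wdist c (Falg gfin) \is a fin_num.
  by move: Tfin; rewrite split_sum fin_numD => /andP[].
move: HJ; rewrite -(fineK Jfin) -(fineK Dfin) -EFinN -!EFinD lte_fin lee_fin; lra.
Qed.

Lemma cauchy_limit (u : nat -> R) :
  (forall e, 0 < e -> exists n0, forall m n, (n0 <= m)%N -> (n0 <= n)%N -> `|u m - u n| <= e) ->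
  exists a, forall e, 0 < e -> exists n0, forall n, (n0 <= n)%N -> `|a - u n| <= e.
Proof.
move=> uC; have /cauchy_cvgP cu : cauchy (u n @[n --> \oo]).
  apply/cauchy_exP => e e0; have [n0 H] := uC (e / 2) (divr_gt0 e0 (ltr0Sn R 1)).
  exists (u n0); exists n0 => // n /= n0n; rewrite /ball/=.
  by rewrite (le_lt_trans (H _ _ (leqnn _) n0n))// ltr_pdivrMr// ltr_pMr// ltr1n.
exists (lim (u n @[n --> \oo])) => e e0.
have /cvgrPdist_le /(_ e e0) [n0 _ H] := cu.
by exists n0 => n /H.
Qed.

(** Limits are taken coefficientwise. The distance is then bounded on each finite list, where
    finitely many coefficients converge together, and the supremum over lists follows. *)
Lemma wcauchy_limit (e : nat -> falg) : wcauchy v e ->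
  exists c, forall eps : R, 0 < eps ->
    exists n0, forall n, (n0 <= n)%N -> (wdist c (e n) <= eps%:E)%E.
Proof.
move=> eC.
have lim_at l : exists z : R[i], forall eps : R, 0 < eps ->
    exists n0, forall n, (n0 <= n)%N -> normc (z - e n l) <= eps.
  have coefC m n : normc (e m l - e n l) <= wnorm v (e m - e n).
    by have := normc_le_wnorm v_ge1 (e m - e n) l; rewrite fcoefD fcoefN.
  have [a Ha] : exists a, forall eps, 0 < eps -> exists n0, forall n, (n0 <= n)%N ->
      `|a - complex.Re (e n l)| <= eps.
    apply: cauchy_limit => eps e0; have [n0 H] := eC eps e0.
    exists n0 => m n n0m n0n; rewrite -raddfB; apply: le_trans (normr_Re_le _) _.
    exact: le_trans (coefC m n) (H _ _ n0m n0n).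
  have [b Hb] : exists a, forall eps, 0 < eps -> exists n0, forall n, (n0 <= n)%N ->
      `|a - complex.Im (e n l)| <= eps.
    apply: cauchy_limit => eps e0; have [n0 H] := eC eps e0.
    exists n0 => m n n0m n0n; rewrite -raddfB; apply: le_trans (normr_Im_le _) _.
    exact: le_trans (coefC m n) (H _ _ n0m n0n).
  exists (a +i* b)%C => eps e0; have e2 : 0 < eps / 2 by rewrite divr_gt0.
  have [n1 H1] := Ha _ e2; have [n2 H2] := Hb _ e2.
  exists (maxn n1 n2) => n; rewrite geq_max => /andP[/H1 h1 /H2 h2].
  rewrite -(@ler_pXn2r _ 2)// ?nnegrE ?normc_ge0 ?(ltW e0)// sqr_normc !raddfB/=.
  move: h1 h2; rewrite !ler_norml => /andP[h1 h1'] /andP[h2 h2'].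
  (* With x the error in one part, (eps/2 - x)(eps/2 + x) >= 0 gives x^2 <= eps^2 / 4; the two parts
     together stay below eps^2. *)
  have k1 := mulr_ge0 (_ : 0 <= eps / 2 - (a - complex.Re (e n l))) (_ : 0 <= eps / 2 + (a - complex.Re (e n l))).
  have k2 := mulr_ge0 (_ : 0 <= eps / 2 - (b - complex.Im (e n l))) (_ : 0 <= eps / 2 + (b - complex.Im (e n l))).
  have {}k1 := k1 ltac:(lra) ltac:(lra); have {}k2 := k2 ltac:(lra) ltac:(lra).
  have := sqr_ge0 eps; rewrite !expr2; move: k1 k2; lra.
pose E l := projT1 (cid (lim_at l)); exists E => eps e0.
have [n0 H] := eC eps e0; exists n0 => n n0n; apply: esum_le_seq => J uJ.
apply/lee_addgt0Pr => eta eta0.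
have [m0 Hm0] : exists m0, forall m, (m0 <= m)%N ->
    \sum_(l <- J) v l * normc (E l - e m l) <= eta.
  elim: {uJ} J eta eta0 => [|l J IH] eta eta0.
    by exists 0%N => m _; rewrite big_nil ltW.
  have eta2 : 0 < eta / 2 by rewrite divr_gt0.
  have [m1 Hm1] := IH _ eta2.
  have vl0 : 0 < v l by exact: lt_le_trans (v_ge1 l).
  have [m2 Hm2] : exists m2, forall m, (m2 <= m)%N -> normc (E l - e m l) <= eta / 2 / v l.
    by rewrite /E; case: cid => z /= Hz; apply: Hz; rewrite divr_gt0.
  exists (maxn m1 m2) => m; rewrite geq_max => /andP[/Hm1 h1 /Hm2 h2].
  rewrite big_cons [leRHS](_ : _ = eta / 2 + eta / 2); last by lra.
  by rewrite lerD// mulrC -ler_pdivlMr.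
pose m := maxn n0 m0.
have hm : \sum_(l <- J) v l * normc (e m l - e n l) <= eps.
  apply: le_trans (H m n (leq_maxl _ _) n0n).
  have -> : \sum_(l <- J) v l * normc (e m l - e n l) = \sum_(l <- J) v l * normc ((e m - e n) l).
    by apply: eq_bigr => l _; rewrite fcoefD fcoefN.
  apply: ler_sum_fsupp => //.
  - by move=> l; rewrite mulr_ge0 ?normc_ge0.
  - by move=> l ->; rewrite Normc.normc0 mulr0.
rewrite sumEFin -EFinD lee_fin addrC.
apply: le_trans (lerD (Hm0 m (leq_maxr _ _)) hm); rewrite -big_split/=.
apply: ler_sum => l _; rewrite -mulrDr ler_wpM2l//.
have -> : E l - e n l = (E l - e m l) + (e m l - e n l) by ring.
exact: normcD_le.
Qed.

Lemma wdist_ell1w c g (a : R) : (wdist c g <= a%:E)%E -> ell1w v c.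
Proof.
move=> ca; apply: (@le_lt_trans _ _ (\esum_(l in [set: tfpt])
   ((v l * normc (c l - g l))%:E + (v l * normc (g l))%:E))%E).
  apply: le_esum => l _; rewrite -EFinD lee_fin -mulrDr ler_wpM2l//.
  by rewrite -[X in normc X <= _](subrK (g l)) normcD_le.
rewrite esumD; last 2 first.
- by move=> l _; exact: (@term_ge0 (fun l => c l - g l)).
- by move=> l _; exact: (@term_ge0 g).
apply: lte_add_pinfty; first exact: le_lt_trans ca (ltry _).
rewrite (esum_seq (fsupp_uniq g)).
- by rewrite sumEFin ltry.
- by move=> l; exact: (@term_ge0 g).
- by move=> l; rewrite mem_fsupp negbK => /eqP ->; rewrite Normc.normc0 mulr0.
Qed.

Lemma opsum_Tf c g (K : R) (f : fn R d) : ell1w v c -> 0 < K -> (wdist c g <= K%:E)%E ->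
  cmeas f -> (l2sq (fun x => (opsum c f x - Tf g f x)%R) <= (2 * K ^+ 2)%:E * l2sq f)%E.
Proof.
move=> c1 K0 cgK mf; apply: opsum_approx => //.
- exact: ell1w_ell1.
- exact: fsupp_uniq.
- by move=> l; rewrite mem_fsupp negbK => /eqP.
- by apply: le_trans cgK; apply: le_esum => l _; rewrite lee_fin ler_peMl ?normc_ge0.
Qed.

Lemma L2_opsum c (f : fn R d) : ell1w v c -> L2 f -> L2 (opsum c f).
Proof.
move=> c1 /L2P[mf ff]; apply/L2P.
have mT := cmeas_opsum (ell1w_ell1 c1) mf; split=> //.
have [g Hg] := ell1w_approx c1 ltr01.
have L2g : L2 (Tf g f) by apply: L2_Tf; exact/L2P.
have /L2P[mg fg] := L2g.
apply: le_lt_trans (l2sqB mT mg) _; apply: lte_add_pinfty; last first.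
  by rewrite lte_mul_pinfty.
rewrite lte_mul_pinfty//; apply: le_lt_trans (opsum_Tf c1 ltr01 Hg mf) _.
by rewrite lte_mul_pinfty// lee_fin mulr_ge0// sqr_ge0.
Qed.
End weighted_l1.

(** * Inverse-closedness *)

Section inverse_closed.
Variables (R : realType) (d : nat).
Local Notation tfpt := (tfpt R d).
Local Notation normc := (@Normc.normc R).
Local Notation falg := (falg R d).
Local Notation fn := (fn R d).
Variable v : tfpt -> R.
Hypothesis v_1 : v 0 = 1.
Hypothesis v_ge1 : forall l, 1 <= v l.
Hypothesis v_sub : forall l m, v (l + m) <= v l * v m.
Hypothesis v_opp : forall l, v (- l) = v l.
Hypothesis v_GRS : forall l (t : R), 1 < t ->
  exists C, forall n, v (l *+ n) <= C * t ^+ n.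

Lemma L2_fin (f : fn) : L2 f -> l2sq f = (fine (l2sq f))%:E.
Proof. by move=> /L2P[_ ff]; rewrite fineK// ge0_fin_numE// l2sq_ge0. Qed.

Lemma l2sqD_fin (f g : fn) (a b : R) : cmeas f -> cmeas g ->
  (l2sq f <= a%:E)%E -> (l2sq g <= b%:E)%E ->
  (l2sq (fun x => (f x + g x)%R) <= (2 * a + 2 * b)%:E)%E.
Proof.
move=> mf mg fa gb; apply: le_trans (l2sqD mf mg) _.
by rewrite (EFinD (2 * a)) (EFinM 2 a) (EFinM 2 b) leeD// lee_wpmul2l// lee_fin.
Qed.

Lemma L2_cmeas (f : fn) : L2 f -> cmeas f.
Proof. by move=> /L2P[]. Qed.

Lemma lower_bound (T S : op R d) : (forall f, L2 f -> L2 (T f)) ->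
  inverse_in_B T S -> exists2 D : R, 0 < D & forall h, L2 h -> (l2sq h <= D%:E * l2sq (T h))%E.
Proof.
move=> TL2 [[SL2 _ [C [C0 SC]]] STf _].
(* Up to a null set h = S (T h), so the bound [C] of [S] bounds [T] below. The factor 2 is the cost
   of [l2sqB], and [C + 1] is positive even if C = 0. *)
exists (2 * (C + 1)); first by rewrite mulr_gt0// ltr_wpDl.
move=> h hL2; have mh := L2_cmeas hL2; have mST := L2_cmeas (SL2 _ (TL2 _ hL2)).
apply: le_trans (l2sqB mh mST) _.
rewrite l2sqC [X in (2%:E * X + _)%E](STf _ hL2) mule0 add0e EFinM -muleA.
apply: lee_wpmul2l => //; apply: le_trans (SC _ (TL2 _ hL2)) _.
by apply: lee_wpmul2r; [exact: l2sq_ge0|rewrite lee_fin lerDl].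
Qed.

Lemma lower_bound_approx (c : tfpt -> R[i]) (D : R) : ell1w v c -> 0 < D ->
  (forall h, L2 h -> (l2sq h <= D%:E * l2sq (opsum c h))%E) ->
  exists2 r : R, 0 < r & forall g : falg, (wdist v c g <= r%:E)%E ->
    forall h, L2 h -> (l2sq h <= (4 * D)%:E * l2sq (Tf g h))%E.
Proof.
(* This radius makes 4 D r^2 <= 1/4: the perturbation is at most a quarter of ||h||^2 and moves to
   the left, leaving (3/4) ||h||^2 <= 2 D ||T_g h||^2. *)
move=> c1 D0 lb; pose r := (4 * (D + 1))^-1.
have D1 : 0 < D + 1 by lra.
have r0 : 0 < r by rewrite invr_gt0 mulr_gt0.
exists r => // g cg h hL2; have mh := L2_cmeas hL2.
have mc := L2_cmeas (L2_opsum v_ge1 c1 hL2).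
have gL2 := L2_Tf g hL2; have mg := L2_cmeas gL2.
have h1 := opsum_Tf v_ge1 c1 r0 cg mh.
have h2 := l2sqB mc mg.
have cE := L2_fin (L2_opsum v_ge1 c1 hL2).
have := lb _ hL2; move: h1 h2; rewrite cE (L2_fin hL2) (L2_fin gL2).
have mB := cmeasB mc mg.
set X := l2sq (fun x => _); move=> h1.
have Xfin : X \is a fin_num by rewrite ge0_fin_numE ?l2sq_ge0// (le_lt_trans h1)// -EFinM ltry.
move: h1; rewrite -(fineK Xfin) -!EFinM -EFinD !lee_fin.
set H := fine (l2sq h); set G := fine (l2sq (Tf g h)); set Y := fine (l2sq (opsum c h)).
set x := fine X => h1 h2 h3.
have H0 : 0 <= H by rewrite fine_ge0// l2sq_ge0.
have Dr : D * (4 * r ^+ 2) <= 1 / 4.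
  have -> : D * (4 * r ^+ 2) = D * (D + 1)^-1 ^+ 2 / 4 by rewrite /r; field; lra.
  rewrite ler_pM2r ?invr_gt0// exprVn ler_pdivrMr ?exprn_gt0// mul1r.
  by have := sqr_ge0 D; rewrite !expr2; lra.
have h4 : D * Y <= D * (2 * x + 2 * G) by rewrite ler_wpM2l ?(ltW D0).
have h5 : D * x <= D * (2 * r ^+ 2 * H) by rewrite ler_wpM2l ?(ltW D0).
have h6 := ler_wpM2r H0 Dr.
have G0 : 0 <= D * G by rewrite mulr_ge0 ?(ltW D0)// fine_ge0// l2sq_ge0.
by rewrite !expr2 in h5 h6 *; lra.
Qed.

Lemma inverse_closed (c : tfpt -> R[i]) (S : op R d) : ell1w v c ->
  inverse_in_B (opsum c) S ->
  exists e : tfpt -> R[i], ell1w v e /\ forall f, L2 f -> eqL2 (S f) (opsum e f).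
Proof.
move=> c1 inv.
have [[SL2 _ _] _ TS] := inv.
(* Transference needs a function of nonzero norm. The case distinction spares exhibiting one: if all
   functions in [L2] were null, the zero symbol would represent [S]. *)
have [[phi phiL2 phi0]|nophi] := pselect (exists2 phi : fn, L2 phi & l2sq phi != 0%E); last first.
  exists (fun=> 0); split.
    rewrite /ell1w (@esum_seq _ _ _ [::])// ?big_nil ?ltry//;
      by move=> l; rewrite Normc.normc0 mulr0.
  move=> f fL2; apply/eqP; apply: contra_notT nophi => h; exists (S f); first exact: SL2.
  apply: contra h => /eqP h; rewrite -h; apply/eqP/iint_eq => x.
  by rewrite opsum0 subr0.
have [D0 D0p lb0] := lower_bound (fun f => L2_opsum v_ge1 c1 (f := f)) inv.
have [r r0 lb] := lower_bound_approx c1 D0p lb0.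
pose D := 4 * D0; have Dp : 0 < D by rewrite mulr_gt0.
have rn n : 0 < r / n.+1%:R by rewrite divr_gt0.
have /choice[g Hg] : forall n : nat, exists g : falg, (wdist v c g <= (r / n.+1%:R)%:E)%E.
  by move=> n; exact: ell1w_approx.
have gr n : (wdist v c (g n) <= r%:E)%E.
  by apply: le_trans (Hg n) _; rewrite lee_fin ler_pdivrMr// ler_peMr ?ler1n// ltW.
have gsmall (k : R) : 0 < k -> exists n0, forall n, (n0 <= n)%N -> (wdist v c (g n) <= k%:E)%E.
  move=> k0; exists (Num.truncn (r / k)) => n n0n; apply: le_trans (Hg n) _.
  rewrite lee_fin ler_pdivrMr// mulrC -ler_pdivrMr//.
  by apply: (le_trans (ltW (truncnS_gt _))); rewrite ler_nat ltnS.
have gB n : wnorm v (g n) <= wnorm v (g 0%N) + 2 * r.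
  rewrite -[X in wnorm v X](subrK (g 0%N)) addrC.
  apply: le_trans (wnormD v_ge1 _ _) _; rewrite lerD2l.
  by apply: le_trans (wnormB_wdist v_ge1 (gr n) (gr 0%N)) _; lra.
have gC : wcauchy v g.
  move=> eps e0; have [n0 H] := gsmall (eps / 2) (divr_gt0 e0 (ltr0Sn R 1)).
  exists n0 => m n m0 k0; apply: le_trans (wnormB_wdist v_ge1 (H _ m0) (H _ k0)) _; lra.
have lb2 n f : D^-1 * l2norm2 f <= l2norm2 (g n * f).
  rewrite mulrC ler_pdivrMr// mulrC.
  exact: (transference Dp phiL2 phi0 (lb _ (gr n))).
have Di : 0 < D^-1 by rewrite invr_gt0.
have [e eC eg] := approximate_inverse v_1 v_ge1 v_sub v_opp v_GRS Di gB gC lb2.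
have [E HE] := wcauchy_limit v_ge1 eC.
have E1 : ell1w v E.
  by have [n0 H] := HE 1 ltr01; exact: (wdist_ell1w v_ge1 (H n0 (leqnn _))).
exists E; split => // f fL2.
have hL2 := SL2 _ fL2; set h := S f in hL2 *.
have wL2 := L2_opsum v_ge1 c1 hL2; set w := opsum c h in wL2 *.
have wf : l2sq (fun x => w x - f x) = 0%E by exact: TS.
have [n1 Hn1] := eC 1 ltr01.
pose B := wnorm v (e n1) + 1.
have B0 : 0 < B by rewrite ltr_wpDl// (wnorm_ge0 v_ge1).
have eB n : (n1 <= n)%N -> wnorm v (e n) <= B.
  move=> n1n; rewrite -[X in wnorm v X](subrK (e n1)) addrC /B.
  by apply: le_trans (wnormD v_ge1 _ _) _; rewrite lerD2l Hn1.
have [mh mw mf] : [/\ cmeas h, cmeas w & cmeas f] by split; exact: L2_cmeas.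
have mE := L2_cmeas (L2_opsum v_ge1 E1 fL2).
set H := fine (l2sq h); set F := fine (l2sq f).
have H0 : 0 <= H by rewrite fine_ge0// l2sq_ge0.
have F0 : 0 <= F by rewrite fine_ge0// l2sq_ge0.
(* With h = S f and w = T h, split h - E f into (1 - e_n g_n) h, e_n (g_n h - w), e_n (w - f) and
   (e_n - E) f. The third part is null because T S = 1; the others have norm O(k). The nested
   factors 2 come from repeated [l2sqD_fin]. *)
have key (k : R) : 0 < k -> (l2sq (fun x => (h x - opsum E f x)%R) <=
    (2 * (2 * k ^+ 2 * H) + 2 * (2 * (2 * B ^+ 2 * (2 * k ^+ 2 * H)) + 2 * (2 * 0 + 2 * (2 * k ^+ 2 * F))))%:E)%E.
  move=> k0; have [n2 Hn2] := eg k k0; have [n3 Hn3] := HE k k0.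
  have [n4 Hn4] := gsmall k k0.
  pose n := maxn (maxn n1 n2) (maxn n3 n4).
  have i1 : (n1 <= n)%N by rewrite /n !leq_max leqnn.
  have i2 : (n2 <= n)%N by rewrite /n !leq_max leqnn orbT.
  have i3 : (n3 <= n)%N by rewrite /n !leq_max leqnn !orbT.
  have i4 : (n4 <= n)%N by rewrite /n !leq_max leqnn !orbT.
  have A1 : (l2sq (Tf (1 - e n * g n)%R h) <= (2 * k ^+ 2 * H)%:E)%E.
    by rewrite EFinM -L2_fin//; exact: (Tf_bound v_ge1 k0 (Hn2 n i2) mh).
  have A2 : (l2sq (Tf (e n) (fun x => (Tf (g n) h x - w x)%R)) <= (2 * B ^+ 2 * (2 * k ^+ 2 * H))%:E)%E.
    have mgw : cmeas (fun x => Tf (g n) h x - w x) by apply: cmeasB => //; exact: cmeas_Tf.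
    apply: le_trans (Tf_bound v_ge1 B0 (eB n i1) mgw) _.
    rewrite [leRHS]EFinM; apply: lee_wpmul2l; first by rewrite lee_fin mulr_ge0// sqr_ge0.
    by rewrite l2sqC EFinM -L2_fin//; exact: (opsum_Tf v_ge1 c1 k0 (Hn4 n i4) mh).
  have A3 : (l2sq (Tf (e n) (fun x => (w x - f x)%R)) <= 0%:E)%E.
    have mwf : cmeas (fun x => w x - f x) by exact: cmeasB.
    by apply: le_trans (Tf_bound v_ge1 B0 (eB n i1) mwf) _; rewrite wf mule0.
  have A4 : (l2sq (fun x => (Tf (e n) f x - opsum E f x)%R) <= (2 * k ^+ 2 * F)%:E)%E.
    by rewrite l2sqC EFinM -L2_fin//; exact: (opsum_Tf v_ge1 E1 k0 (Hn3 n i3) mf).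
  have m4 : cmeas (fun x => Tf (e n) f x - opsum E f x) by apply: cmeasB => //; exact: cmeas_Tf.
  have m3 : cmeas (Tf (e n) (fun x => w x - f x)) by apply: cmeas_Tf; exact: cmeasB.
  have m2 : cmeas (Tf (e n) (fun x => Tf (g n) h x - w x)).
    by apply: cmeas_Tf; apply: cmeasB => //; exact: cmeas_Tf.
  have m1 : cmeas (Tf (1 - e n * g n) h) by exact: cmeas_Tf.
  have A34 := l2sqD_fin m3 m4 A3 A4; have m34 := cmeasD m3 m4.
  have A234 := l2sqD_fin m2 m34 A2 A34; have m234 := cmeasD m2 m34.
  have := l2sqD_fin m1 m234 A1 A234.
  rewrite (_ : l2sq _ = l2sq (fun x => h x - opsum E f x))//.
  apply: iint_eq => x; congr ((normc _ ^+ 2)%:E).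
  rewrite TfD TfN Tf1 TfM !TfBr; ring.
apply/eqP; rewrite eq_le l2sq_ge0 andbT.
(* [Q] collects the coefficients of k^2 in [key], plus 1 for positivity; k is then chosen with k^2 =
   eps / Q. *)
pose Q := 4 * H + 16 * B ^+ 2 * H + 16 * F + 1.
have BH : 0 <= B ^+ 2 * H by rewrite mulr_ge0// sqr_ge0.
have Q0 : 0 < Q by rewrite /Q; lra.
apply/lee_addgt0Pr => eps e0; rewrite add0e.
have sk : 0 < Num.sqrt (eps / Q) by rewrite sqrtr_gt0 divr_gt0.
apply: le_trans (key _ sk) _; rewrite lee_fin sqr_sqrtr; last by rewrite divr_ge0 ?ltW.
apply: (@le_trans _ _ (eps / Q * Q)); last by rewrite divfK// gt_eqF.
have : 0 <= eps / Q by rewrite divr_ge0 ?ltW.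
rewrite /Q; move: (eps / _) => y y0; rewrite -subr_ge0.
rewrite (_ : _ - _ = y); first by [].
by ring.
Qed.
End inverse_closed.

(** * Consequences of admissibility *)

Section admissible_weights.
Variables (R : realType) (d : nat).
Local Notation tfpt := (tfpt R d).
Variable v : tfpt -> R.
Hypothesis adm : admissible v.

(** Symmetry and submultiplicativity give 1 = v(l - l) <= v(l) v(-l) = v(l)^2. *)
Lemma admissible_ge1 l : 1 <= v l.
Proof.
have [[v0 v1 vN _] vM _ _] := adm.
have := vM l (tf_opp l); rewrite vN.
have -> : tf_add l (tf_opp l) = tf_zero R d by rewrite /tf_add /= !addrN.
rewrite v1 -expr2 => h; rewrite -(@ler_pXn2r _ 2)// ?nnegrE ?v0//.
by rewrite expr1n.
Qed.

Lemma enorm2dMn (l : tfpt) n : enorm2d (l *+ n) = n%:R * enorm2d l.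
Proof.
have -> : l *+ n = (n%:R *: l.1, n%:R *: l.2).
  elim: n => [|n IH]; first by rewrite mulr0n !scale0r.
  by rewrite mulrS IH -!natr1 !scalerDl !scale1r addrC; case: l {IH}.
rewrite /enorm2d /= !dotvZl !dotvZr.
have -> : n%:R * (n%:R * dotv l.1 l.1) + n%:R * (n%:R * dotv l.2 l.2) =
   n%:R ^+ 2 * (dotv l.1 l.1 + dotv l.2 l.2) by ring.
by rewrite sqrtrM ?sqr_ge0// sqrtr_sqr ger0_norm.
Qed.

Lemma admissible_GRS l (t : R) : 1 < t -> exists C, forall n, v (l *+ n) <= C * t ^+ n.
Proof.
move=> t1; have [[v0 _ _ _] _ wfin wlim] := adm.
have r0 : 0 <= enorm2d l by rewrite sqrtr_ge0.
have t0 : 0 <= t by rewrite (le_trans ler01)// ltW.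
have vw n : v (l *+ n) <= fine (wmax v (n%:R * enorm2d l)).
  have le : ((v (l *+ n))%:E <= wmax v (n%:R * enorm2d l))%E.
    by apply: ereal_sup_ubound; exists (l *+ n) => //; rewrite /= enorm2dMn.
  rewrite -lee_fin fineK// ge0_fin_numE.
    by apply: wfin; rewrite mulr_ge0.
  by apply: le_trans le; rewrite lee_fin.
have t10 : 0 < t - 1 by lra.
have /cvgrPdist_le /(_ _ t10) [n0 _ H] := wlim _ r0.
(* Convergence of the roots is used from n0 + 1 on, where n > 0 allows the n-th root to be undone;
   the sum dominates the finitely many earlier values. *)
exists (1 + \sum_(n < n0.+1) v (l *+ n)) => n.
have tn : 1 <= t ^+ n by rewrite exprn_ege1// ltW.
have S0 : 0 <= \sum_(n < n0.+1) v (l *+ n) by apply: sumr_ge0 => i _.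
rewrite mulrDl mul1r; have [nn0|nn0] := ltnP n n0.+1.
  apply: (@le_trans _ _ (\sum_(n < n0.+1) v (l *+ n))).
    by rewrite (bigD1 (Ordinal nn0))//= lerDl sumr_ge0.
  rewrite (@le_trans _ _ ((\sum_(n < n0.+1) v (l *+ n)) * t ^+ n)) ?ler_peMr//.
  by rewrite lerDr exprn_ge0.
apply: (@le_trans _ _ (t ^+ n)); last by rewrite lerDl mulr_ge0// exprn_ge0.
apply: le_trans (vw n) _.
have := H n (ltnW nn0); rewrite /= distrC => h.
have {}h : powR (fine (wmax v (n%:R * enorm2d l))) n%:R^-1 <= t.
  by have := le_trans (ler_norm _) h; lra.
have n_gt0 : (0 < n)%N by exact: leq_trans nn0.
set x := fine _ in h *.
have x0 : 0 <= x by apply: le_trans (vw n).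
have -> : x = powR x n%:R^-1 ^+ n.
  by rewrite -powR_mulrn ?powR_ge0// -powRrM mulVf ?powRr1// pnatr_eq0 -lt0n.
by rewrite lerXn2r ?nnegrE ?powR_ge0.
Qed.
End admissible_weights.

Theorem theorem2 (R : realType) (d : nat) :
  (forall (v : tfpt R d -> R) (c : tfpt R d -> R[i]),
     admissible v -> ell1w v c ->
     forall S : op R d, inverse_in_B (opsum c) S ->
     exists e : tfpt R d -> R[i],
       ell1w v e /\ forall f, L2 f -> eqL2 (S f) (opsum e f))
  /\
  (forall c : tfpt R d -> R[i], ell1 c ->
     forall S : op R d, inverse_in_B (opsum c) S ->
     exists e : tfpt R d -> R[i],
       ell1 e /\ forall f, L2 f ->
         eqL2 (S f) (fun x => csum (fun s : tfpt R d =>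
                        if s \in supp e then e s * U s f x else 0))).
Proof.
split=> [v c adm c1 S inv|c c1 S inv].
  have [[_ v1 vN _] vM _ _] := adm.
  by apply: (inverse_closed v1 (admissible_ge1 adm) vM vN (admissible_GRS adm) c1 inv).
(* For d = 0 no weight is admissible, as spheres of positive radius are empty; hence
   the constant weight is treated directly and not through the first part. *)
have ell1E (a : tfpt R d -> R[i]) : ell1w (fun=> 1) a <-> ell1 a.
  by rewrite /ell1w /ell1; under eq_esum do rewrite mul1r.
have [] := @inverse_closed R d (fun=> 1) _ _ _ _ _ c S _ inv => //.
- by move=> l m; rewrite mulr1.
- by move=> l t t1; exists 1 => n; rewrite mul1r exprn_ege1// ltW.
- exact/ell1E.
move=> e [/ell1E e1 eS]; exists e; split => // f /eS.
rewrite (_ : opsum e f = fun x => csum (fun s : tfpt R d =>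
   if s \in supp e then e s * U s f x else 0))//.
apply/funext => x; congr csum; apply/funext => s; case: ifPn => //.
by rewrite notin_setE => /negP; rewrite negbK => /eqP ->; rewrite mul0r.
Qed.
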